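(* Let $f\in\mathbb{R}[t_1,\dots,t_n]$ be a homogeneous polynomial of degree $d\ge2$, let $\mathscr{K}$ be an open convex cone, and let $S_\mathscr{K}$ denote the set of unit vectors which generate extreme rays of $\overline{\mathscr{K}}$. Then $f$ is $\mathscr{K}$-Lorentzian if and only if (i) $D_{\mathbf{u}_1}\cdots D_{\mathbf{u}_d}f\ge0$ for all $\mathbf{u}_1,\dots,\mathbf{u}_d\in S_\mathscr{K}$; (ii) for all $\mathbf{u}_1,\dots,\mathbf{u}_{2d}\in S_\mathscr{K}$, the set $\{\alpha\in\mathbb{N}^{2d}:\alpha_1+\dots+\alpha_{2d}=d,\ D_{\mathbf{u}_1}^{\alpha_1}\cdots D_{\mathbf{u}_{2d}}^{\alpha_{2d}}f>0\}$ is M-convex; (iii) for all $\mathbf{u}_3,\dots,\mathbf{u}_d\in S_\mathscr{K}$, the symmetric bilinear form $(\mathbf{x},\mathbf{y})\mapsto D_\mathbf{x}D_\mathbf{y}D_{\mathbf{u}_3}\cdots D_{\mathbf{u}_d}f$ has at most one positive eigenvalue.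
   Context: $D_\mathbf{u}=\sum u_i\partial_i$. A homogeneous $f$ of degree $d\ge1$ is $\mathscr{K}$-Lorentzian if for all $\mathbf{v}_1,\dots,\mathbf{v}_d\in\mathscr{K}$, $D_{\mathbf{v}_1}\cdots D_{\mathbf{v}_d}f>0$ and (when $d\ge2$) $(\mathbf{x},\mathbf{y})\mapsto D_\mathbf{x}D_\mathbf{y}D_{\mathbf{v}_3}\cdots D_{\mathbf{v}_d}f$ has exactly one positive eigenvalue. A finite $\mathrm{M}\subset\mathbb{N}^m$ is M-convex if whenever $\alpha,\beta\in\mathrm{M}$ and $\alpha_i>\beta_i$ there is $j$ with $\beta_j>\alpha_j$ and $\alpha-e_i+e_j\in\mathrm{M}$.
   Formalization: The formal theorem also assumes that f is nonzero, that the open convex cone is nonempty, and that its closure contains no line; for a half-space there are no extreme rays and f = -t_n^d satisfies (i)-(iii) without being Lorentzian. *)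

(* Defs.v *)
From HB Require Import structures.
From mathcomp Require Import all_boot all_order all_algebra.
From mathcomp Require Import polyrcf.
From mathcomp Require Import boolp classical_sets functions cardinality reals.
From mathcomp Require Import topology.
(* [convex] and [normedtype] are not imported: their notations clash with
   those of [mpoly]. *)
From mathcomp Require convex.
From mathcomp Require Import mpoly.

Set Implicit Arguments.
Unset Strict Implicit.
Unset Printing Implicit Defensive.

Import Order.TTheory GRing.Theory Num.Theory.
Import numFieldTopology.Exports.

Local Open Scope classical_set_scope.
Local Open Scope ring_scope.

Definition dirderiv (R : realType) (n : nat) (u : 'rV[R]_n)
    (f : {mpoly R[n]}) : {mpoly R[n]} :=
  \sum_(i < n) u 0 i *: mderiv i f.

(* D_{u_1} ... D_{u_k} f for us = [:: u_1; ...; u_k] *)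
Definition dirderivs (R : realType) (n : nat) (us : seq 'rV[R]_n)
    (f : {mpoly R[n]}) : {mpoly R[n]} :=
  foldr (@dirderiv R n) f us.

(* D_{u_1}^{alpha_1} ... D_{u_m}^{alpha_m} f *)
Definition dirderivX (R : realType) (n m : nat) (u : m.-tuple 'rV[R]_n)
    (alpha : 'X_{1..m}) (f : {mpoly R[n]}) : {mpoly R[n]} :=
  foldr (fun i g => iter (alpha i) (dirderiv (tnth u i)) g) f (enum 'I_m).

(* The d-th derivatives of a form of degree d are constant polynomials, which
   are identified with real numbers through their constant coefficient. *)
Definition mconst (R : realType) (n : nat) (f : {mpoly R[n]}) : R := f@_(0%MM).

(* (x, y) |-> D_x D_y D_{u_3} ... D_{u_d} f, where us = [:: u_3; ...; u_d] *)
Definition hess_form (R : realType) (n : nat) (us : seq 'rV[R]_n)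
    (f : {mpoly R[n]}) (x y : 'rV[R]_n) : R :=
  mconst (dirderiv x (dirderiv y (dirderivs us f))).

(* Number of positive eigenvalues of a symmetric bilinear form, i.e. of its
   matrix in the standard basis, counted with (algebraic) multiplicity. *)
Definition npos_eig (R : realType) (n : nat)
    (B : 'rV[R]_n -> 'rV[R]_n -> R) : nat :=
  let p := char_poly (\matrix_(i < n, j < n)
                        B (delta_mx 0 i) (delta_mx 0 j)) in
  (\sum_(x <- rootsR p | (0 < x)%R) mup x p)%N.

Definition Lorentzian (R : realType) (n d : nat) (K : set 'rV[R]_n)
    (f : {mpoly R[n]}) : Prop :=
  [/\ (1 <= d)%N, f \is d.-homog &
   forall v : d.-tuple 'rV[R]_n, (forall i, K (tnth v i)) ->
     0 < mconst (dirderivs v f) /\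
     ((2 <= d)%N -> npos_eig (hess_form (drop 2 v) f) = 1%N)].

Definition Mconvex (m : nat) (M : set 'X_{1..m}) : Prop :=
  finite_set M /\
  forall alpha beta, M alpha -> M beta ->
    forall i : 'I_m, (beta i < alpha i)%N ->
      exists j : 'I_m, (alpha j < beta j)%N /\ M (alpha - U_(i) + U_(j))%MM.

Definition open_convex_cone (R : realType) (n : nat) (K : set 'rV[R]_n) : Prop :=
  [/\ K !=set0, open K, convex.convex_set K &
   forall (c : R) x, 0 < c -> K x -> K (c *: x)].

Definition pointed (R : realType) (n : nat) (C : set 'rV[R]_n) : Prop :=
  forall x, C x -> C (- x) -> x = 0.

Definition ray (R : realType) (n : nat) (u : 'rV[R]_n) : set 'rV[R]_n :=
  [set c *: u | c in [set c : R | 0 <= c]].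

Definition extreme_ray (R : realType) (n : nat) (C r : set 'rV[R]_n) : Prop :=
  r `<=` C /\ forall x y, C x -> C y -> r (x + y) -> r x /\ r y.

(* Euclidean unit vectors; the library norm on 'rV[R]_n is the sup norm. *)
Definition unit_extreme (R : realType) (n : nat) (K : set 'rV[R]_n) :
    set 'rV[R]_n :=
  [set u : 'rV[R]_n | \sum_(i < n) u 0 i ^+ 2 = 1 /\ extreme_ray (closure K) (ray u)].

(* Main.v *)
Require Import Defs.
From mathcomp Require Import all_boot all_order all_algebra.
From mathcomp Require Import polyrcf complex.
From mathcomp Require Import boolp classical_sets functions cardinality reals.
From mathcomp Require Import topology.
From mathcomp Require convex interval_inference.
From mathcomp Require Import ring lra.
From mathcomp Require Import mpoly.

Set Implicit Arguments.
Unset Strict Implicit.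
Unset Printing Implicit Defensive.

Import Order.TTheory GRing.Theory Num.Theory.
Import numFieldTopology.Exports.

Local Open Scope classical_set_scope.
Local Open Scope ring_scope.

(** Everything is expressed through the polarization
    [F (u_1, ..., u_d) = D_{u_1} ... D_{u_d} f], and "at most one positive
    eigenvalue" through the reversed Cauchy-Schwarz inequality, a closed condition.

    If [f] is [K]-Lorentzian then by continuity [F >= 0] and all Hessians are
    hyperbolic on [closure K].  If [F (b, ..., b) > 0] and
    [F (y, b, ..., b) = 0], then [y] lies in the kernel of the hyperbolic form
    [F (., ., b, ..., b)], and, replacing one [b] at a time by [z + b],
    [F (y, ., ..., .) = 0] on the cone.  Hence [F (b, ..., b) > 0] and
    [F (y_1, ..., y_d) > 0] imply [F (b, y_2, ..., y_d) > 0]; with [b] the sum of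
    the vectors occurring in [beta] this is the exchange property of the support.

    Conversely, by Minkowski's theorem every vector of [closure K] is a
    nonnegative combination of extreme unit vectors, so that one works with a
    polynomial on an orthant.  By induction on the degree all [T (e_k, ., .)] are
    hyperbolic, where [T] is a cubic form with nonnegative coefficients, and one
    needs the same for [H = T (w, ., .)] with [w > 0].  Summing the reversed
    Cauchy-Schwarz inequalities at [w] gives
    [z H z <= sum_k w_k (H z)_k^2 / (H w)_k], so that for
    [P = diag ((H w)_k / w_k)] the eigenvalues [a] of [P^-1 H] satisfy [a <= a^2];
    by Perron-Frobenius they are at most [1], and M-convexity makes the graph of
    [H] connected, so that the eigenvalue [1] is simple. *)

(** * Real symmetric matrices and hyperbolic forms *)

Section Spectral.
Context {R : realType}.

(** Over the complex numbers [M] is Hermitian, so its spectral diagonal is real; a diagonal entry is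
    a root of the real characteristic polynomial, which gives a real eigenvector. *)
Lemma symmx_eigenvector n (M : 'M[R]_n.+1) : M^T = M ->
  exists a, exists2 v : 'rV_n.+1, v != 0 & v *m M = a *: v.
Proof.
move=> Msym; pose A : 'M[R[i]]_n.+1 := map_mx (real_complex R) M.
have Areal : A \is a mxOver Num.real.
  by apply/mxOverP => i j; rewrite mxE complex_real.
have Aherm : A \is sesquilinear.hermsymmx.
  apply: realsym_hermsym => //; apply/is_hermitianmxP.
  by rewrite expr0 scale1r; apply/matrixP => i j; rewrite !mxE -{1}Msym mxE.
have /orthomx_spectralP Aeq := hermitian_normalmx Aherm.
have /mxOverP dreal := hermitian_spectral_diag_real Aherm.
set P := spectralmx A in Aeq; set d := spectral_diag A in Aeq dreal.
have PA : P *m A = diag_mx d *m P.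
  by rewrite {1}Aeq mulmxA mulKVmx ?spectral_unit.
have [a da] : exists a, d 0 0 = real_complex R a.
  exact/complex_realP/dreal.
have : eigenvalue A (real_complex R a).
  apply/eigenvalueP; exists (row 0 P).
    by rewrite -row_mul PA mul_diag_mx -da; apply/rowP => j; rewrite !mxE.
  have : row_free P by rewrite row_free_unit spectral_unit.
  apply: contraTneq => P0; apply/negP => /row_freeP[Q] /(congr1 (row 0)).
  rewrite row_mul P0 mul0mx => /rowP/(_ 0); rewrite !mxE eqxx => /eqP.
  by rewrite eq_sym oner_eq0.
rewrite eigenvalue_root_char -map_char_poly fmorph_root -eigenvalue_root_char.
by move=> /eigenvalueP[v vM vN0]; exists a, v.
Qed.

(* The Householder reflection exchanging the first basis vector and [v]. *)
Lemma unit_row_extend n (v : 'rV[R]_n.+1) : v *m v^T = 1%:M ->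
  exists2 Q : 'M_n.+1, Q *m Q^T = 1%:M & row 0 Q = v.
Proof.
move=> v1; pose e : 'rV[R]_n.+1 := delta_mx 0 0; pose u := v - e.
have ve : v *m e^T = (v 0 0)%:M.
  by apply/rowP => i; rewrite !ord1 !mxE (bigD1 0)//= big1 => [|j j0];
     rewrite !mxE ?eqxx ?mulr1 ?addr0// (negPf j0) mulr0.
have ev : e *m v^T = (v 0 0)%:M by rewrite -[LHS]trmxK trmx_mul trmxK ve tr_scalar_mx.
have ee : e *m e^T = 1%:M.
  by rewrite trmx_delta mul_delta_mx; apply/rowP => i; rewrite !ord1 !mxE.
have uu : u *m u^T = (2 - v 0 0 *+ 2)%:M.
  rewrite /u mulmxBl linearB/= !mulmxBr v1 ve ev ee.
  by apply/rowP => i; rewrite !ord1 !mxE/= !mulr1n; ring.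
have eu : e *m u^T = (v 0 0 - 1)%:M.
  by rewrite /u linearB/= mulmxBr ev ee; apply/rowP => i; rewrite !ord1 !mxE/= !mulr1n.
have -> : v = e + u by rewrite addrC subrK.
move: (v 0 0) uu eu => v00 uu eu {ve ev v1}.
clearbody u; have [v01|v01] := eqVneq v00 1.
  exists 1%:M; first by rewrite trmx1 mulmx1.
  have : \sum_i u 0 i ^+ 2 = 0.
    move: uu; rewrite v01 subrr => /rowP/(_ 0); rewrite !mxE mul0rn => h.
    by rewrite -[RHS]h; apply: eq_bigr => i _; rewrite !mxE.
  move/eqP; rewrite psumr_eq0 => [/allP u0|i _]; last exact: sqr_ge0.
  have -> : u = 0.
    apply/rowP => i; have := u0 i (mem_index_enum i).
    by rewrite sqrf_eq0 => /eqP ->; rewrite mxE.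
  by rewrite addr0; apply/rowP => i; rewrite !mxE eqxx eq_sym.
pose c := 2 / (2 - v00 *+ 2).
have den : 2 - v00 *+ 2 != 0.
  by apply: contra_neq v01; rewrite -mulr_natr => h; lra.
pose Q : 'M[R]_n.+1 := 1%:M - c *: (u^T *m u).
have QT : Q^T = Q.
  by rewrite /Q linearB linearZ/= trmx_mul trmxK trmx1.
exists Q.
  have uuu : u^T *m u *m (u^T *m u) = (2 - v00 *+ 2) *: (u^T *m u).
    by rewrite mulmxA -[u^T *m u *m u^T]mulmxA uu mul_mx_scalar -scalemxAl.
  rewrite QT /Q mulmxBl mul1mx -scalemxAl mulmxBr mulmx1 -scalemxAr uuu.
  move: (u^T *m u) => X; apply/matrixP => i j; rewrite !mxE /c.
  by field; rewrite mulr_natr.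
rewrite rowE -/e /Q mulmxBr mulmx1 -scalemxAr mulmxA eu mul_scalar_mx scalerA.
have -> : c * (v00 - 1) = -1 by rewrite /c; field; rewrite mulr_natr.
by rewrite scaleN1r opprK.
Qed.

(** Deflation: conjugating by an orthogonal matrix whose first row is a unit eigenvector splits off
    a block of size one, and symmetry makes the result block diagonal. *)
Theorem symmx_spectral n (M : 'M[R]_n) : M^T = M ->
  exists O : 'M_n, exists2 d : 'rV_n,
    O *m O^T = 1%:M & M = O^T *m diag_mx d *m O.
Proof.
elim: n M => [|n IHn] M Msym.
  by exists 1%:M, 0; [rewrite trmx1 mulmx1 | apply/matrixP => -[]].
have [a [v0 v0N0 v0M]] := symmx_eigenvector Msym.
have s_gt0 : 0 < \sum_i v0 0 i ^+ 2.
  rewrite lt_neqAle sumr_ge0 ?andbT => [|i _]; last exact: sqr_ge0.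
  rewrite eq_sym psumr_eq0 => [|i _]; last exact: sqr_ge0.
  apply: contra v0N0 => /allP h; apply/eqP/rowP => i; rewrite mxE.
  by have := h i (mem_index_enum i); rewrite sqrf_eq0 => /eqP.
pose v := (Num.sqrt (\sum_i v0 0 i ^+ 2))^-1 *: v0.
have vv : v *m v^T = 1%:M.
  rewrite /v linearZ/= -scalemxAl -scalemxAr scalerA -invfM -expr2.
  rewrite sqr_sqrtr ?ltW// [v0 *m _]mx11_scalar [(v0 *m _) 0 0]mxE.
  under [X in _ *: X%:M]eq_bigr do rewrite mxE -expr2.
  by rewrite scale_scalar_mx mulVf ?gt_eqF.
have vM : v *m M = a *: v by rewrite -scalemxAl v0M !scalerA mulrC.
have [Q QQ Qv] := unit_row_extend vv.
have QTQ : Q^T *m Q = 1%:M by apply: mulmx1C.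
pose N : 'M_(1 + n) := Q *m M *m Q^T.
have Nsym : N^T = N by rewrite /N !trmx_mul trmxK Msym mulmxA.
have N0 : row 0 N = a *: delta_mx 0 0.
  rewrite /N -mulmxA row_mul Qv mulmxA vM -scalemxAl -Qv -row_mul QQ.
  by congr (_ *: _); rewrite rowE mulmx1.
have NE : N = block_mx a%:M 0 0 (drsubmx N).
  have NE0 j : N 0 j = a * (j == 0)%:R.
    by move/rowP/(_ j): N0; rewrite [row 0 N 0 j]mxE => ->; rewrite !mxE.
  have l0 (i : 'I_1) : lshift n i = 0 by apply/val_inj; rewrite /= ord1.
  have ur : ursubmx N = 0.
    apply/matrixP => i j.
    by rewrite /ursubmx mxE [usubmx _ _ _]mxE l0 NE0 mulr0 mxE.
  rewrite -[LHS]submxK ur; congr block_mx.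
    apply/matrixP => i j.
    by rewrite /ulsubmx mxE [usubmx _ _ _]mxE !l0 NE0 !ord1 !mxE mulr1.
  by rewrite -[LHS]trmxK trmx_dlsub Nsym ur trmx0.
have [O' [d' OO' N'E]] : exists O' : 'M_n, exists2 d' : 'rV_n,
    O' *m O'^T = 1%:M & drsubmx N = O'^T *m diag_mx d' *m O'.
  by apply: IHn; rewrite trmx_drsub Nsym.
pose B : 'M_(1 + n) := block_mx 1%:M 0 0 O'.
have BB : B *m B^T = 1%:M.
  rewrite tr_block_mx mulmx_block !trmx0 trmx1 !(mulmx0, mul0mx, mulmx1) !(addr0, add0r).
  by rewrite OO' -scalar_mx_block.
pose d : 'rV_(1 + n) := row_mx a%:M d'.
have BdB : B^T *m diag_mx d *m B = N.
  rewrite diag_mx_row tr_block_mx !trmx0 trmx1.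
  rewrite !mulmx_block !(mulmx0, mul0mx, mulmx1, mul1mx) !(addr0, add0r) -N'E.
  have -> : diag_mx (a%:M : 'rV_1) = a%:M.
    by apply/matrixP => i j; rewrite !ord1 mxE eqxx mulr1n.
  by rewrite [RHS]NE mul0mx.
clearbody B d; exists ((B : 'M_n.+1) *m Q), (d : 'rV_n.+1).
  by rewrite trmx_mul mulmxA -[_ *m Q *m _]mulmxA QQ mulmx1.
transitivity (Q^T *m N *m Q).
  by rewrite /N !mulmxA QTQ mul1mx -mulmxA QTQ mulmx1.
by rewrite -BdB trmx_mul !mulmxA.
Qed.

Lemma char_poly_orthogonal n (O : 'M[R]_n) (d : 'rV_n) : O *m O^T = 1%:M ->
  char_poly (O^T *m diag_mx d *m O) = \prod_(i < n) ('X - (d 0 i)%:P).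
Proof.
move=> /mulmx1C OO; transitivity (char_poly (diag_mx d)); last first.
  rewrite char_poly_trig ?diag_mx_is_trig//.
  by apply: eq_bigr => i _; rewrite mxE eqxx.
have OOP : map_mx polyC O^T *m map_mx polyC O = 1%:M by rewrite -map_mxM OO map_mx1.
rewrite /char_poly /char_poly_mx !map_mxM/=.
have -> : 'X%:M - map_mx polyC O^T *m map_mx polyC (diag_mx d) *m map_mx polyC O =
    map_mx polyC O^T *m ('X%:M - map_mx polyC (diag_mx d)) *m map_mx polyC O.
  rewrite mulmxBr mulmxBl mul_mx_scalar -scalemxAl OOP.
  by rewrite scalemx1.
by rewrite !det_mulmx mulrAC -det_mulmx OOP det1 mul1r.
Qed.

End Spectral.

Lemma sum_bool_gt1 (I : finType) (P : pred I) : (1 < \sum_i P i)%N ->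
  exists i j, [/\ j != i, P i & P j].
Proof.
move=> gt1; have [i Pi] : exists i, P i.
  apply/existsP; apply: contraLR gt1; rewrite negb_exists => /forallP h.
  by rewrite big1// => i _; rewrite (negbTE (h i)).
have [j /andP[ji Pj]] : exists j, (j != i) && P j.
  apply/existsP; apply: contraLR gt1; rewrite negb_exists => /forallP h.
  rewrite (bigD1 i)//= big1 => [|j ji]; first by rewrite Pi.
  by have := h j; rewrite ji/= => /negbTE ->.
by exists i, j.
Qed.

Section HyperbolicForms.
Context {R : realType}.

Definition sym_bilinear (V : lmodType R) (B : V -> V -> R) : Prop :=
  (forall x y, B x y = B y x) /\
  (forall c x y z, B (c *: x + y) z = c * B x z + B y z).

(* For a symmetric bilinear form this reversed Cauchy-Schwarz inequality says
   that there is at most one positive eigenvalue. *)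
Definition hyperbolic (V : lmodType R) (B : V -> V -> R) : Prop :=
  forall a x, 0 < B a a -> B x x * B a a <= B a x ^+ 2.

(** If the conclusion failed by [D > 0], the terms of order one and two in [e] could not make up for
    [D] when [e] is small. *)
Lemma reversed_CS_limit (p q r p' q' r' : R) : 0 < p ->
  (forall e, 0 < e -> 0 < p + e * p' ->
     (q + e * q') * (p + e * p') <= (r + e * r') ^+ 2) ->
  q * p <= r ^+ 2.
Proof.
move=> p0 hyp; rewrite leNgt; apply/negP => lt.
pose C1 := `|2 * r * r' - q * p' - q' * p|; pose C2 := `|r' ^+ 2 - q' * p'|.
pose D := q * p - r ^+ 2.
have D0 : 0 < D by rewrite /D subr_gt0.
have C0 : 0 < C1 + C2 + 1 by rewrite ltr_wpDl// addr_ge0 // normr_ge0.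
have p'0 : 0 < `|p'| + 1 by rewrite ltr_wpDl.
(* The bound [1] gives [e ^+ 2 <= e], the second makes the perturbation smaller than [D], the third
   keeps [p + e * p'] positive. *)
pose e := Num.min 1 (Num.min (D / (C1 + C2 + 1)) (p / (`|p'| + 1))).
have e0 : 0 < e by rewrite /e !lt_min ltr01 !divr_gt0.
have e1 : e <= 1 by rewrite /e ge_min lexx.
have eD : e * (C1 + C2 + 1) <= D.
  by rewrite -ler_pdivlMr// /e !ge_min lexx orbT.
have ep : e * (`|p'| + 1) <= p.
  by rewrite -ler_pdivlMr// /e !ge_min lexx !orbT.
have := hyp e e0.
have p'n : - p' <= `|p'| by rewrite -normrN ler_norm.
have -> : 0 < p + e * p' by nra.
move=> /(_ isT) h.
have h1 : 2 * r * r' - q * p' - q' * p <= C1 by exact: ler_norm.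
have h2 : r' ^+ 2 - q' * p' <= C2 by exact: ler_norm.
have C2p : 0 <= C2 by exact: normr_ge0.
have : D <= e * C1 + e * (e * C2).
  apply: (le_trans (y := e * (2 * r * r' - q * p' - q' * p) +
                        e * (e * (r' ^+ 2 - q' * p')))).
    by rewrite /D; move: h; nra.
  by rewrite lerD// !ler_pM2l.
have : e * (e * C2) <= e * C2 by rewrite ler_pM2l// ler_piMl.
by nra.
Qed.

Section SymBilinear.
Context {V : lmodType R} {B : V -> V -> R} (Bsb : sym_bilinear B).

Lemma sbC x y : B x y = B y x. Proof. by case: Bsb. Qed.

Lemma sbDl x y z : B (x + y) z = B x z + B y z.
Proof. by case: Bsb => _ /(_ 1 x y z); rewrite scale1r mul1r. Qed.

Lemma sb0l x : B 0 x = 0.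
Proof. by apply: (addrI (B 0 x)); rewrite -sbDl !addr0. Qed.

Lemma sbZl c x y : B (c *: x) y = c * B x y.
Proof. by case: Bsb => _ /(_ c x 0 y); rewrite addr0 sb0l addr0. Qed.

Lemma sbDr x y z : B x (y + z) = B x y + B x z.
Proof. by rewrite sbC sbDl !(sbC _ x). Qed.

Lemma sbZr c x y : B x (c *: y) = c * B x y.
Proof. by rewrite sbC sbZl sbC. Qed.

Lemma sb_suml (I : Type) (r : seq I) (F : I -> V) y :
  B (\sum_(i <- r) F i) y = \sum_(i <- r) B (F i) y.
Proof. by apply: (big_morph (B^~ y)) => [u v|]; rewrite ?sbDl ?sb0l. Qed.

Lemma sb_sumr (I : Type) (r : seq I) (F : I -> V) y :
  B y (\sum_(i <- r) F i) = \sum_(i <- r) B y (F i).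
Proof. by rewrite sbC sb_suml; apply: eq_bigr => i _; rewrite sbC. Qed.

(** The vector [y = l a *: x - l x *: a] lies in the kernel of [l]. Multiplying [B y y <= 0] by
    [B a a] and completing the square leaves the reversed Cauchy-Schwarz inequality times
    [l a ^+ 2]. *)
Lemma hyperbolic_hyperplane (l : V -> R) :
  (forall c x y, l (c *: x + y) = c * l x + l y) ->
  (forall x, l x = 0 -> B x x <= 0) -> hyperbolic B.
Proof.
move=> llin lneg a x Baa.
have la0 : l a != 0 by apply/eqP => /lneg; rewrite leNgt Baa.
pose y := l a *: x + - l x *: a.
have ly : l y = 0.
  have l0 : l 0 = 0 by have := llin 1 0 0; rewrite scale1r addr0; lra.
  by rewrite llin -[_ *: a]addr0 llin l0 addr0; ring.
have := lneg _ ly; rewrite /y !(sbDl, sbDr, sbZl, sbZr) (sbC x a) => h.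
have la2 : 0 < l a ^+ 2 by rewrite exprn_even_gt0.
rewrite -(ler_pM2l la2).
have := sqr_ge0 (l a * B a x - l x * B a a).
have := ler_wpM2r (ltW Baa) h.
by nra.
Qed.

(* A vector orthogonal to [b] on which the form is nonnegative is in the kernel,
   because the form is negative semidefinite on the orthogonal of [b]. *)
Lemma hyperbolic_kernel b y z : hyperbolic B -> 0 < B b b -> B b y = 0 ->
  0 <= B y y -> B y z = 0.
Proof.
move=> Bhyp Bbb Bby Byy.
pose z' := z + - (B b z / B b b) *: b.
have Bz' : B b z' = 0 by rewrite sbDr sbZr mulNr divfK ?subrr ?gt_eqF.
have Byz : B y z = B y z' by rewrite sbDr sbZr (sbC y b) Bby mulr0 addr0.
have neg x : B b x = 0 -> B x x <= 0.
  move=> bx; have := Bhyp b x Bbb; rewrite bx expr0n/=.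
  by rewrite pmulr_lle0.
have Byy0 : B y y = 0 by apply/eqP; rewrite eq_le Byy neg.
rewrite Byz; apply/eqP/negPn/negP => yz0.
(* Since [B y y = 0], the form is affine in [t] along [z' + t *: y]; this [t] gives it the value
   [1], although [z' + t *: y] is orthogonal to [b]. *)
clearbody z'; pose t := (1 - B z' z') / (2 * B y z').
have : B (z' + t *: y) (z' + t *: y) <= 0.
  by apply: neg; rewrite sbDr sbZr Bz' Bby mulr0 addr0.
rewrite !(sbDl, sbDr, sbZl, sbZr) Byy0 (sbC z' y).
have -> : B z' z' + t * B y z' + (t * B y z' + t * (t * 0)) = 1.
  by rewrite /t; field.
by rewrite ler10.
Qed.

Lemma hyperbolic_limit (B' : V -> V -> R) :
  (forall e, 0 < e -> hyperbolic (fun x y => B x y + e * B' x y)) ->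
  hyperbolic B.
Proof.
move=> hyp a x Baa; apply: (@reversed_CS_limit _ _ _ (B' a a) (B' x x) (B' a x)) => //.
by move=> e e0; exact: hyp.
Qed.

End SymBilinear.

Section Signature.
Context {n : nat} {B : 'rV[R]_n -> 'rV[R]_n -> R} (Bsb : sym_bilinear B).

Lemma npos_eig_spectral : exists O : 'M[R]_n, exists d : 'rV[R]_n,
  [/\ O *m O^T = 1%:M,
      forall x y, B x y = \sum_i d 0 i * (x *m O^T) 0 i * (y *m O^T) 0 i &
      npos_eig B = (\sum_(i < n) (0 < d 0 i)%R)%N].
Proof.
pose M := \matrix_(i, j) B (delta_mx 0 i) (delta_mx 0 j).
have Msym : M^T = M by apply/matrixP => i j; rewrite !mxE sbC.
have [O [d OO ME]] := symmx_spectral Msym.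
exists O, d; split => //.
  move=> x y; have -> : B x y = (x *m M *m y^T) 0 0.
    rewrite -mulmxA [RHS]mxE {1}[x]row_sum_delta sb_suml//.
    apply: eq_bigr => i _; rewrite sbZl// mxE {1}[y]row_sum_delta sb_sumr//.
    by congr (_ * _); apply: eq_bigr => j _; rewrite sbZr// !mxE mulrC.
  have -> : x *m M *m y^T = x *m O^T *m diag_mx d *m (y *m O^T)^T.
    by rewrite ME trmx_mul trmxK !mulmxA.
  by rewrite mul_mx_diag mxE; apply: eq_bigr => i _; rewrite !mxE mulrAC mulrC mulrA.
rewrite /npos_eig -/M ME char_poly_orthogonal//.
set p := \prod_(i < n) _.
pose s := [seq d 0 i | i <- enum 'I_n].
have pE : p = \prod_(x <- s) ('X - x%:P) by rewrite big_map big_enum.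
have p0 : p != 0 by rewrite pE monic_neq0// monic_prod_XsubC.
transitivity (count (fun x => 0 < x) s); last first.
  by rewrite count_map -sum1_count big_mkcond/= big_enum/=; apply: eq_bigr => i _; case: ifP.
have -> : count (fun x => 0 < x) s = (\sum_(y <- s) (0 < y)%R)%N.
  by rewrite -sum1_count big_mkcond; apply: eq_bigr => y _; case: ifP.
(* Multiplicities summed over the distinct positive roots are exchanged into a count of the positive
   diagonal entries. *)
under eq_bigr do rewrite {1}pE mu_prod_XsubC -sum1_count big_mkcond/=.
rewrite exchange_big/= big_seq [RHS]big_seq; apply: eq_bigr => y ys.
have yr : y \in rootsR p.
  have := roots_on_rootsR p0 y; rewrite in_itv/= => <-.
  by rewrite pE root_prod_XsubC.
have ru : uniq [seq x <- rootsR p | 0 < x] by rewrite filter_uniq// uniq_roots.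
have := count_uniq_mem y ru.
rewrite mem_filter yr andbT -sum1_count big_filter_cond/= big_mkcondr/= => <-.
by apply: eq_bigr => x _; rewrite eq_sym.
Qed.

(** With a single positive diagonal entry the form is nonpositive on the hyperplane where that
    coordinate vanishes. Two positive entries give orthogonal eigenvectors that violate the
    inequality. *)
Lemma npos_eig_le1 : (npos_eig B <= 1)%N <-> hyperbolic B.
Proof.
have [O [d [OO BE ->]]] := npos_eig_spectral.
have OK (z : 'rV[R]_n) : z *m O *m O^T = z by rewrite -mulmxA OO mulmx1.
split=> [le1|hyp].
  have [[i di]|none] := pselect (exists i, 0 < d 0 i); last first.
    move=> a x; rewrite BE ltNge sumr_le0// => j _.
    rewrite -mulrA -expr2 mulr_le0_ge0 ?sqr_ge0// leNgt.
    by apply/negP => dj; apply: none; exists j.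
  have dj j : j != i -> d 0 j <= 0.
    move=> ji; rewrite leNgt; apply/negP => dj; move: le1.
    by rewrite (bigD1 i)//= (bigD1 j)//= di dj.
  apply: (@hyperbolic_hyperplane _ _ Bsb (fun x => (x *m O^T) 0 i)).
    by move=> c x y; rewrite mulmxDl -scalemxAl !mxE.
  move=> x x0; rewrite BE (bigD1 i)//= x0 mulr0 add0r sumr_le0// => j ji.
  by rewrite -mulrA -expr2 mulr_le0_ge0 ?sqr_ge0 ?dj.
rewrite leqNgt; apply/negP => gt1.
have [i [j [ji di dj]]] := sum_bool_gt1 gt1.
have Be k l : B (delta_mx 0 k *m O) (delta_mx 0 l *m O) = d 0 k * (k == l)%:R.
  rewrite BE !OK (bigD1 k)//= big1 => [|m mk]; last by rewrite !mxE (negPf mk) mulr0 mul0r.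
  by rewrite !mxE !eqxx addr0 mulr1.
have := hyp (delta_mx 0 i *m O) (delta_mx 0 j *m O).
rewrite !Be !eqxx !mulr1 eq_sym (negPf ji) mulr0 expr0n/= => /(_ di).
by rewrite leNgt mulr_gt0.
Qed.

Lemma npos_eig_gt0 x : 0 < B x x -> (0 < npos_eig B)%N.
Proof.
have [O [d [OO BE ->]]] := npos_eig_spectral.
rewrite BE lt0n; apply: contraTN; rewrite sum_nat_eq0 => /forallP d0.
rewrite -leNgt sumr_le0// => i _.
rewrite -mulrA -expr2 mulr_le0_ge0 ?sqr_ge0// leNgt.
by have := d0 i; rewrite eqb0.
Qed.

End Signature.
End HyperbolicForms.

(** * Symmetric multilinear functionals and M-convexity of supports *)

Lemma map_const_nseq (S U : Type) (x : U) (s : seq S) :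
  map (fun=> x) s = nseq (size s) x.
Proof. by elim: s => //= ? s ->. Qed.

Section SymMultilinear.
Context {R : realType} {V : lmodType R}.
Implicit Types (T : seq V -> R) (C : set V).

Definition sym_multilinear T : Prop :=
  (forall s t, perm_eq s t -> T s = T t) /\
  (forall c x y s, T (c *: x + y :: s) = c * T (x :: s) + T (y :: s)).

Lemma smD T x y s : sym_multilinear T -> T (x + y :: s) = T (x :: s) + T (y :: s).
Proof. by move=> [_ /(_ 1 x y s)]; rewrite scale1r mul1r. Qed.

Lemma sm0 T s : sym_multilinear T -> T (0 :: s) = 0.
Proof. by move=> Tsm; apply: (addrI (T (0 :: s))); rewrite -smD// !addr0. Qed.

Lemma smZ T c x s : sym_multilinear T -> T (c *: x :: s) = c * T (x :: s).
Proof. by move=> Tsm; have := Tsm.2 c x 0 s; rewrite addr0 sm0// addr0. Qed.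

Lemma sm_sum T (I : Type) (r : seq I) (F : I -> V) s : sym_multilinear T ->
  T (\sum_(i <- r) F i :: s) = \sum_(i <- r) T (F i :: s).
Proof.
by move=> Tsm; apply: (big_morph (fun v => T (v :: s))) => [u v|]; rewrite ?smD ?sm0.
Qed.

Lemma sm_cons T v : sym_multilinear T -> sym_multilinear (fun s => T (v :: s)).
Proof.
move=> [Tp Tl]; split=> [s t st|c x y s]; first by apply: Tp; rewrite perm_cons.
have sw a b : T [:: a, b & s] = T [:: b, a & s].
  by apply: Tp; rewrite -[a :: _]/([:: a] ++ [:: b] ++ s) perm_catCA.
by rewrite sw Tl !(sw v).
Qed.

Lemma sm_cat T l : sym_multilinear T -> sym_multilinear (fun s => T (l ++ s)).
Proof. by elim: l T => // v l IHl T Tsm; exact/(IHl (fun s => T (v :: s)))/sm_cons. Qed.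

Lemma sm_bilinear T s : sym_multilinear T -> sym_bilinear (fun x y => T [:: x, y & s]).
Proof.
move=> [Tp Tl]; split=> // x y.
by apply: Tp; rewrite -[x :: _]/([:: x] ++ [:: y] ++ s) perm_catCA.
Qed.

(* The closed analogue of being Lorentzian, which is inherited by limits. *)
Definition weakly_Lorentzian C (d : nat) T : Prop :=
  [/\ sym_multilinear T,
      forall s, size s = d -> (forall x, x \in s -> C x) -> 0 <= T s &
      forall s, (size s).+2 = d -> (forall x, x \in s -> C x) ->
        hyperbolic (fun x y => T [:: x, y & s])].

Lemma weakly_Lorentzian_cons C d T v : C v ->
  weakly_Lorentzian C d.+1 T -> weakly_Lorentzian C d (fun s => T (v :: s)).
Proof.
move=> Cv [Tsm Tpos Thyp]; split; first exact: sm_cons.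
  by move=> s sd Cs; apply: Tpos => [|x]; rewrite /= ?sd// inE => /predU1P[->|/Cs].
move=> s sd Cs a x.
have sw y z : T [:: v, y, z & s] = T [:: y, z, v & s].
  by apply: Tsm.1; rewrite -[v :: _]/([:: v] ++ [:: y; z] ++ s) perm_catCA.
rewrite !sw; apply: (Thyp (v :: s)); first by rewrite /= sd.
by move=> y; rewrite inE => /predU1P[->|/Cs].
Qed.

Lemma weakly_Lorentzian_cat C d T l : (forall x, x \in l -> C x) ->
  weakly_Lorentzian C (size l + d) T -> weakly_Lorentzian C d (fun s => T (l ++ s)).
Proof.
elim: l T => // v l IHl T Cl wT; apply: (IHl (fun s => T (v :: s))).
  by move=> x xl; apply: Cl; rewrite inE xl orbT.
by apply: weakly_Lorentzian_cons => //; apply: Cl; rewrite mem_head.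
Qed.

(** By multilinearity the arguments grow one at a time, each change adding a value of [T] on vectors
    of [C]; the tail [r] stays fixed. *)
Lemma weakly_Lorentzian_mono C d T (I : eqType) (f g : I -> V) l r :
  (forall x y, C x -> C y -> C (x + y)) -> weakly_Lorentzian C d T ->
  (size l + size r)%N = d -> (forall i, i \in l -> C (f i)) ->
  (forall i, i \in l -> C (g i)) -> (forall x, x \in r -> C x) ->
  T (map f l ++ r) <= T (map (fun i => f i + g i) l ++ r).
Proof.
move=> CD; elim: l d T => [//|i l IHl] d T wT sd Cf Cg Cr /=.
have [Tsm Tpos _] := wT; rewrite smD//.
have Cf' j : j \in l -> C (f j) by move=> jl; apply: Cf; rewrite inE jl orbT.
have Cg' j : j \in l -> C (g j) by move=> jl; apply: Cg; rewrite inE jl orbT.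
rewrite -[leLHS]addr0 lerD//.
  rewrite -sd addSn in wT; apply: (IHl _ (fun s => T (f i :: s))) => //.
  by apply: weakly_Lorentzian_cons wT; apply: Cf; rewrite mem_head.
apply: Tpos; first by rewrite /= size_cat size_map.
move=> x; rewrite inE => /predU1P[->|]; first by apply: Cg; rewrite mem_head.
rewrite mem_cat => /orP[/mapP[j jl ->]|/Cr//].
by apply: CD; [exact: Cf'|exact: Cg'].
Qed.

(** Induction on the number [k] of copies of [b] that have been replaced. Shifting the replaced
    arguments by [b] keeps the form positive at [b], and the induction hypothesis makes [y]
    orthogonal to [b]; so [y] is in the kernel, and monotonicity removes the shift. *)
Lemma weakly_Lorentzian_kernel C e T b y : (forall x y, C x -> C y -> C (x + y)) ->
  weakly_Lorentzian C e.+1 T -> C b -> C y ->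
  0 < T (nseq e.+1 b) -> T (y :: nseq e b) = 0 ->
  forall k z, (k <= e)%N -> size z = k -> (forall x, x \in z -> C x) ->
    T (y :: z ++ nseq (e - k) b) = 0.
Proof.
move=> CD wT Cb Cy Tb Ty; have [Tsm Tpos Thyp] := wT.
elim=> [|k IHk] z ke sz Cz; first by rewrite (size0nil sz) subn0.
case: z sz Cz => [//|x z] [sz] Cz.
have Cx : C x by apply: Cz; rewrite mem_head.
have {}Cz v : v \in z -> C v by move=> vz; apply: Cz; rewrite inE vz orbT.
pose zb := map (fun v => v + b) z; pose r := nseq (e - k.+1) b.
have Czb v : v \in zb -> C v by move=> /mapP[w /Cz Cw ->]; exact: CD.
have Cr v : v \in r -> C v by rewrite mem_nseq => /andP[_ /eqP->].
have Czr v : v \in zb ++ r -> C v by rewrite mem_cat => /orP[/Czb|/Cr].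
have eS : e = (k + (e - k.+1)).+1 by rewrite -addSn subnKC.
have szr : (size (zb ++ r)).+2 = e.+1.
  by rewrite size_cat size_map size_nseq sz -eS.
have TC s : size s = e.+1 -> (forall v, v \in s -> C v) -> 0 <= T s by exact: Tpos.
have C3 v w s : C v -> C w -> (forall x, x \in s -> C x) ->
    forall x, x \in [:: v, w & s] -> C x.
  by move=> Cv Cw Cs u; rewrite !inE => /or3P[/eqP->|/eqP->|/Cs].
have kerz : T [:: y, x & zb ++ r] = 0.
  apply: (@hyperbolic_kernel _ _ _ (sm_bilinear (zb ++ r) Tsm) b); first exact: Thyp.
  - apply: lt_le_trans Tb _.
    have -> : nseq e.+1 b = [:: b; b] ++ map (fun=> b) z ++ r.
      by rewrite map_const_nseq sz -nseqD -[RHS]/(nseq (k + (e - k.+1)).+2 b) -eS.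
    have := @weakly_Lorentzian_mono C e.+1 T _ (fun=> b) id z ([:: b; b] ++ r) CD wT.
    have pc (s t : seq V) : T (s ++ [:: b; b] ++ t) = T ([:: b; b] ++ s ++ t).
      by apply: Tsm.1; rewrite perm_catCA.
    have -> : zb = map (fun v => b + v) z by apply: eq_map => v; rewrite addrC.
    rewrite !pc; apply => //; last exact: C3.
    by rewrite /= size_nseq sz !addnS -eS.
  - have -> : T [:: b, y & zb ++ r] = T (y :: zb ++ nseq (e - k) b).
      apply: Tsm.1; rewrite -[b :: _]/([:: b] ++ [:: y] ++ _) perm_catCA/= perm_cons.
      rewrite -cat1s perm_catCA perm_cat2l /r.
      by rewrite (_ : e - k = (e - k.+1).+1)%N //; rewrite subnS prednK// subn_gt0.
    by apply: IHk => //; [exact: ltnW | rewrite size_map].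
  - by apply: TC; [rewrite /= szr | exact: C3].
apply/eqP; rewrite eq_le; apply/andP; split; last first.
  apply: TC; first by rewrite /= size_cat sz size_nseq -eS.
  by apply: C3 => // v; rewrite mem_cat => /orP[/Cz|/Cr].
rewrite -[leRHS]kerz.
have := @weakly_Lorentzian_mono C e.+1 T _ id (fun=> b) z ([:: y; x] ++ r) CD wT.
have pc (s t : seq V) : T (s ++ [:: y; x] ++ t) = T ([:: y; x] ++ s ++ t).
  by apply: Tsm.1; rewrite perm_catCA.
rewrite !pc map_id; apply => //; last exact: C3.
by rewrite /= size_nseq sz !addnS -eS.
Qed.

(** Freeze [y1] and use induction. Were [T (y1, b, ..., b)] zero, the kernel lemma would make [T]
    vanish on all lists of cone vectors containing [y1], against positivity at [y :: y1 :: ys]. *)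
Lemma weakly_Lorentzian_replace C T b y ys : (forall x y, C x -> C y -> C (x + y)) ->
  weakly_Lorentzian C (size ys).+1 T -> C b -> C y -> (forall x, x \in ys -> C x) ->
  0 < T (nseq (size ys).+1 b) -> 0 < T (y :: ys) -> 0 < T (b :: ys).
Proof.
move=> CD; elim: ys T => [//|y1 ys IHys] T wT Cb Cy Cys Tb Ty.
have [Tsm Tpos _] := wT.
have Cy1 : C y1 by apply: Cys; rewrite mem_head.
have {}Cys v : v \in ys -> C v by move=> vz; apply: Cys; rewrite inE vz orbT.
have sw a : T [:: a, y1 & ys] = T [:: y1, a & ys].
  by apply: Tsm.1; rewrite -[a :: _]/([:: a] ++ [:: y1] ++ ys) perm_catCA.
rewrite sw in Ty; rewrite sw.
refine (IHys (fun s => T (y1 :: s)) _ Cb Cy Cys _ Ty).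
  exact: weakly_Lorentzian_cons.
rewrite lt_neqAle Tpos ?andbT.
- rewrite eq_sym; apply: contraTneq Ty => T0; rewrite -leNgt.
  have := weakly_Lorentzian_kernel CD wT Cb Cy1 Tb T0 (k := (size ys).+1) (z := y :: ys).
  rewrite subnn cats0 => -> // v.
  by rewrite inE => /predU1P[->|/Cys].
- by rewrite /= size_nseq.
- by move=> x; rewrite inE mem_nseq => /predU1P[->|/andP[_ /eqP->]].
Qed.

End SymMultilinear.

(** Used to freeze the common arguments of two members of a support, so that only disjoint
    remainders need an exchange. *)
Lemma multiset_cancel (I : eqType) (a b : seq I) : exists c a' b',
  [/\ perm_eq a (c ++ a'), perm_eq b (c ++ b') & forall x, x \in a' -> x \notin b'].
Proof.
elim: a => [|x a [c [a' [b' [ac bc dis]]]]]; first by exists [::], [::], b.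
have [xb|xb] := boolP (x \in b').
  exists (x :: c), a', (rem x b'); split=> [||y ya].
  - by rewrite perm_cons.
  - apply: perm_trans bc _; rewrite perm_sym -[X in perm_eq X]/([:: x] ++ c ++ _).
    by rewrite perm_catCA perm_cat2l perm_sym perm_to_rem.
  - by apply: contra (dis _ ya); exact: mem_rem.
exists c, (x :: a'), b'; split=> // [|y].
  by rewrite perm_sym -[X in perm_eq X]/(c ++ [:: x] ++ a') perm_catCA perm_cons perm_sym.
by rewrite inE => /predU1P[->|/dis].
Qed.

(** An exponent is encoded as a list in which each index is repeated with its multiplicity;
    [j :: rem i a] is the exchanged exponent. *)
Definition seq_Mconvex (I : eqType) (J : seq I -> Prop) : Prop :=
  forall a b, J a -> J b -> forall i, (count_mem i b < count_mem i a)%N ->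
    exists2 j, (count_mem j a < count_mem j b)%N & J (j :: rem i a).

Lemma weakly_Lorentzian_Mconvex (R : realType) (V : lmodType R) (C : set V) d
    (T : seq V -> R) (I : eqType) (u : I -> V) :
  C 0 -> (forall x y, C x -> C y -> C (x + y)) -> (forall i, C (u i)) ->
  weakly_Lorentzian C d T ->
  seq_Mconvex (fun a => size a = d /\ 0 < T (map u a)).
Proof.
move=> C0 CD Cu wT a b [sa Ta] [sb Tb] i ci.
have [c [a' [b' [ac bc dis]]]] := multiset_cancel a b.
have [Tsm _ _] := wT.
have cnt x s t : perm_eq s (c ++ t) -> count_mem x s = (count_mem x c + count_mem x t)%N.
  by move=> /permP->; rewrite count_cat.
have ia' : i \in a'.
  move: ci; rewrite (cnt _ _ _ ac) (cnt _ _ _ bc) ltn_add2l -has_pred1 has_count.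
  exact: leq_ltn_trans.
have sab : size a' = size b'.
  by apply/eqP; rewrite -(eqn_add2l (size c)) -!size_cat -(perm_size ac) -(perm_size bc) sa sb.
pose a'' := rem i a'.
have a'E : perm_eq a' (i :: a'') by rewrite perm_to_rem.
have sa'' : size b' = (size a'').+1 by rewrite -sab (perm_size a'E).
pose T' s := T (map u c ++ s).
have Cm s x : x \in map u s -> C x by move=> /mapP[j _ ->].
have wT' : weakly_Lorentzian C (size b') T'.
  apply: weakly_Lorentzian_cat; first exact: Cm.
  by rewrite size_map -size_cat -(perm_size bc) sb.
have [T'sm _ _] := wT'.
have T'a : 0 < T' (u i :: map u a'').
  rewrite /T' (Tsm.1 _ (map u a))// -map_cons -map_cat perm_map// perm_sym.
  by apply: perm_trans ac _; rewrite perm_cat2l.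
have T'b : 0 < T' (map u b').
  by rewrite /T' (Tsm.1 _ (map u b))// -map_cat perm_map// perm_sym.
(* Each [v - u j] is in the cone, so [T'] is positive at [(v, ..., v)] by monotonicity. Then [v] may
   replace [u i], and expanding [v] finds the index [j], which is not in [a']. *)
pose v := \sum_(j <- b') u j.
have Csum s : C (\sum_(j <- s) u j) by apply: big_rec => // j x _; exact: CD.
have : 0 < T' (v :: map u a'').
  apply: (@weakly_Lorentzian_replace _ _ C T' v (u i)) => //.
  - by rewrite size_map -sa''.
  - exact: Csum.
  - exact: Cm.
  rewrite size_map -sa''; apply: lt_le_trans T'b _.
  have := @weakly_Lorentzian_mono _ _ C _ T' _ u (fun j => v - u j) b' [::] CD wT'.
  have -> : map (fun j => u j + (v - u j)) b' = nseq (size b') v.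
    by rewrite -map_const_nseq; apply: eq_map => j; rewrite addrC subrK.
  rewrite !cats0; apply => //; rewrite ?addn0// => j jb.
  by rewrite /v (big_rem _ jb)/= addrAC subrr add0r.
rewrite /v sm_sum// => pos.
have [j jb Tj] : exists2 j, j \in b' & 0 < T' (u j :: map u a'').
  have : has (fun j => 0 < T' (u j :: map u a'')) b'.
    apply: contraLR pos => /hasPn h; rewrite -leNgt big_seq sumr_le0// => j jb.
    by rewrite leNgt h.
  by move=> /hasP.
have ja' : j \notin a' by apply: contraTN jb => /dis.
exists j.
  rewrite (cnt _ _ _ ac) (cnt _ _ _ bc) ltn_add2l (count_memPn ja').
  by rewrite -has_count has_pred1.
have ia : i \in a by rewrite (perm_mem ac) mem_cat ia' orbT.
have perm : perm_eq (j :: rem i a) (c ++ j :: a'').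
  rewrite perm_sym -[X in perm_eq X]/(c ++ [:: j] ++ a'') perm_catCA perm_cons.
  rewrite perm_sym -(perm_cons i) perm_sym.
  apply: perm_trans (perm_to_rem ia); rewrite perm_sym; apply: perm_trans ac _.
  by rewrite perm_sym -[X in perm_eq X]/([:: i] ++ c ++ a'') perm_catCA perm_cat2l perm_sym.
split; first by rewrite /= size_rem// prednK// -?has_predT ?sa//; case: (a) ia.
by rewrite (Tsm.1 _ (map u (c ++ j :: a''))) ?perm_map// map_cat.
Qed.

(** * Hyperbolicity on the orthant *)

Section Limits.
Context {R : realType} {V : lmodType R} (T : seq V -> R) (Tsm : sym_multilinear T).
Variables (P C : set V) (k : V).
Hypothesis CP : forall v e, C v -> 0 < e -> P (v + e *: k).

Let permT l v r : T (l ++ v :: r) = T (v :: l ++ r).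
Proof. by apply: Tsm.1; rewrite -[v :: r]cat1s perm_catCA. Qed.

Lemma nonneg_limit d : (forall s, size s = d -> (forall x, x \in s -> P x) -> 0 <= T s) ->
  forall s, size s = d -> (forall x, x \in s -> C x) -> 0 <= T s.
Proof.
move=> Tpos s sd Cs; rewrite -[s]cats0.
have : forall x : V, x \in [::] -> P x by [].
have : (size s + @size V [::])%N = d by rewrite addn0.
elim: s [::] Cs {sd} => [|v s IHs] r Cs sd Pr; first by exact: Tpos.
have Cv : C v by apply: Cs; rewrite mem_head.
have h e : 0 < e -> 0 <= T (v :: s ++ r) + e * T (k :: s ++ r).
  move=> e0; rewrite -smZ// -smD// -permT; apply: IHs.
  - by move=> x xs; apply: Cs; rewrite inE xs orbT.
  - by rewrite -sd /= addnS.
  - by move=> x; rewrite inE => /predU1P[->|/Pr//]; exact: CP.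
rewrite leNgt; apply/negP => neg; set a := T _ in neg h; set b := T _ in h.
have b1 : 0 < `|b| + 1 by rewrite ltr_wpDl.
(* For this small [e] the value [a + e * b] is at most [a / 2], hence still negative. *)
have := h _ (divr_gt0 (_ : 0 < - a / 2) b1); rewrite divr_gt0 ?oppr_gt0// => /(_ isT).
have : - a / 2 / (`|b| + 1) * b <= - a / 2.
  rewrite mulrAC ler_pdivrMr// ler_pM2l ?divr_gt0 ?oppr_gt0//.
  by rewrite (le_trans (ler_norm b))// lerDl.
by lra.
Qed.

Lemma hyperbolic_closure d :
  (forall s, size s = d -> (forall x, x \in s -> P x) ->
     hyperbolic (fun x y => T [:: x, y & s])) ->
  forall s, size s = d -> (forall x, x \in s -> C x) ->
     hyperbolic (fun x y => T [:: x, y & s]).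
Proof.
move=> Thyp s sd Cs; rewrite -[s]cats0.
have : forall x : V, x \in [::] -> P x by [].
have : (size s + @size V [::])%N = d by rewrite addn0.
elim: s [::] Cs {sd} => [|v s IHs] r Cs sd Pr; first by exact: Thyp.
have Cv : C v by apply: Cs; rewrite mem_head.
apply: (@hyperbolic_limit _ _ _ (fun x y => T [:: x, y & k :: s ++ r])) => e e0.
have -> : (fun x y => T [:: x, y & (v :: s) ++ r] + e * T [:: x, y & k :: s ++ r]) =
          (fun x y => T [:: x, y & s ++ (v + e *: k) :: r]).
  apply/funext => x; apply/funext => y.
  have -> u : T [:: x, y & s ++ u :: r] = T (u :: [:: x, y & s ++ r]).
    by rewrite (permT [:: x, y & s]).
  have pu u : T [:: x, y & u :: s ++ r] = T (u :: [:: x, y & s ++ r]).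
    by rewrite (permT [:: x; y]).
  by rewrite !pu smD// smZ.
apply: IHs.
- by move=> x xs; apply: Cs; rewrite inE xs orbT.
- by rewrite -sd /= addnS.
- by move=> x; rewrite inE => /predU1P[->|/Pr//]; exact: CP.
Qed.

End Limits.

(** * Positive combinations of the derivatives of a cubic form *)

Section CubicStep.
Context {R : realType} {m : nat}.
Implicit Types x y z : 'rV[R]_m.

Local Notation dot x y := (\sum_i x 0 i * y 0 i).
Local Notation "''e' i" := (delta_mx 0 i : 'rV[R]_m) (at level 10, i at level 8).

(** Rows of the diagonalizing orthogonal matrix are orthonormal eigenvectors, so a second positive
    eigenvalue supplies the pair [y], [z]. *)
Lemma hyperbolic_eigen (B : 'rV[R]_m -> 'rV[R]_m -> R) : sym_bilinear B ->
  (forall a b y z, 0 < a -> 0 < b ->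
     (forall x, B y x = a * dot y x) -> (forall x, B z x = b * dot z x) ->
     dot y y = 1 -> dot z z = 1 -> dot y z = 0 -> False) -> hyperbolic B.
Proof.
move=> Bsb eig; apply/(npos_eig_le1 Bsb).
have [O [d [OO BE ->]]] := npos_eig_spectral Bsb.
rewrite leqNgt; apply/negP => gt1.
have [i [j [ji di dj]]] := sum_bool_gt1 gt1.
have rowO k x : (x *m O^T) 0 k = dot (row k O) x.
  by rewrite mxE; apply: eq_bigr => l _; rewrite !mxE mulrC.
have dotO k l : dot (row k O) (row l O) = (k == l)%:R.
  by rewrite -rowO -row_mul OO !mxE eq_sym.
have Brow k x : B (row k O) x = d 0 k * dot (row k O) x.
  rewrite BE (bigD1 k)//= big1 => [|l lk]; last first.
    by rewrite rowO dotO (negPf lk) mulr0 mul0r.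
  by rewrite !rowO dotO eqxx mulr1 addr0.
by apply: (eig _ _ _ _ di dj (Brow i) (Brow j)); rewrite dotO ?eqxx// eq_sym (negPf ji).
Qed.

Variables (B : 'I_m -> 'rV[R]_m -> 'rV[R]_m -> R) (w : 'rV[R]_m).
Hypothesis Bsb : forall k, sym_bilinear (B k).
Hypothesis Bhyp : forall k, hyperbolic (B k).
Hypothesis Bsym : forall i k z, B k ('e i) z = B i ('e k) z.
Hypothesis B_ge0 : forall k i j, 0 <= B k ('e i) ('e j).
Hypothesis w_gt0 : forall k, 0 < w 0 k.

(** With [B k] read as [T (e_k, ., .)], these are [T (w, ., .)] and [T (e_k, w, w)]. *)
Let H x y := \sum_k w 0 k * B k x y.
Let q k := H ('e k) w.

Hypothesis connected : forall i j, 0 < q i -> 0 < q j ->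
  i = j \/ 0 < H ('e i) ('e j) \/
  exists p, 0 < H ('e i) ('e p) /\ 0 < H ('e p) ('e j).

Let Hsb : sym_bilinear H.
Proof.
split=> [x y|c x y z]; first by apply: eq_bigr => k _; rewrite (sbC (Bsb k)).
rewrite mulr_sumr -big_split/=; apply: eq_bigr => k _.
by rewrite (sbDl (Bsb k)) (sbZl (Bsb k)); ring.
Qed.

Let expandl (F : 'rV[R]_m -> 'rV[R]_m -> R) x y : sym_bilinear F ->
  F x y = \sum_i x 0 i * F ('e i) y.
Proof.
move=> Fsb; rewrite {1}[x]row_sum_delta sb_suml//.
by apply: eq_bigr => i _; rewrite sbZl.
Qed.

Let Bw k z : B k w z = H ('e k) z.
Proof. by rewrite expandl//; apply: eq_bigr => i _; rewrite Bsym. Qed.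

Let H_ge0 i j : 0 <= H ('e i) ('e j).
Proof. by apply: sumr_ge0 => k _; rewrite mulr_ge0 ?B_ge0 ?ltW. Qed.

Let qE k : q k = \sum_l w 0 l * H ('e k) ('e l).
Proof. by rewrite /q (sbC Hsb) expandl//; apply: eq_bigr => l _; rewrite (sbC Hsb). Qed.

Let q_ge0 k : 0 <= q k.
Proof. by rewrite qE sumr_ge0// => l _; rewrite mulr_ge0 ?H_ge0 ?ltW. Qed.

Let q0_H k z : q k = 0 -> H ('e k) z = 0.
Proof.
rewrite qE => /eqP; rewrite psumr_eq0 => [/allP h|l _]; last first.
  by rewrite mulr_ge0 ?H_ge0 ?ltW.
rewrite (sbC Hsb) expandl// big1// => l _; have := h l (mem_index_enum l).
by rewrite mulf_eq0 gt_eqF//= (sbC Hsb) => /eqP ->; rewrite mulr0.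
Qed.

Let q0_B k z : q k = 0 -> B k z z = 0.
Proof.
move=> qk0; have HB l i : B l ('e k) ('e i) = 0.
  have := q0_H ('e i) qk0; rewrite /H => /eqP; rewrite psumr_eq0 => [/allP h|j _]; last first.
    by rewrite mulr_ge0 ?B_ge0 ?ltW.
  by have := h l (mem_index_enum l); rewrite mulf_eq0 gt_eqF//= => /eqP.
rewrite expandl// big1// => i _; rewrite Bsym (sbC (Bsb i)) expandl// big1 ?mulr0// => j _.
by rewrite (sbC (Bsb i)) HB mulr0.
Qed.

(** The value [1] on the zero rows of [H] keeps the diagonal matrix invertible. *)
Let P k := if 0 < q k then q k / w 0 k else 1.

Let P_gt0 k : 0 < P k.
Proof. by rewrite /P; case: ifP => // qk; rewrite divr_gt0. Qed.

(** Since [B k w w = q k] and [B k w z = H ('e k) z], this is the sum of the reversed Cauchy-Schwarz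
    inequalities at [w], weighted by [w_k]; the terms with [q k = 0] vanish on the left. *)
Let H_le_sq z : H z z <= \sum_k H ('e k) z ^+ 2 / P k.
Proof.
apply: ler_sum => k _; rewrite /P; case: ifPn => [qk|].
  rewrite invf_div mulrCA ler_pM2l// ler_pdivlMr//.
  by have := @Bhyp k w z; rewrite !Bw; apply.
rewrite -leNgt => qk; have qk0 : q k = 0 by apply/eqP; rewrite eq_le qk q_ge0.
by rewrite q0_B// mulr0 divr1 sqr_ge0.
Qed.

(** In the coordinates [z_k / w_k] the difference is a graph Laplacian with edge weights
    [H_kl w_k w_l], which shows both its sign and its zeros. *)
Let gap z : \sum_k q k / w 0 k * z 0 k ^+ 2 - H z z =
  \sum_k \sum_l 2^-1 * (H ('e k) ('e l) * w 0 k * w 0 l * (z 0 k / w 0 k - z 0 l / w 0 l) ^+ 2).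
Proof.
have Hzz : H z z = \sum_k \sum_l z 0 k * z 0 l * H ('e k) ('e l).
  rewrite expandl//; apply: eq_bigr => k _; rewrite (sbC Hsb) expandl// mulr_sumr.
  by apply: eq_bigr => l _; rewrite (sbC Hsb); ring.
have Qk : \sum_k q k / w 0 k * z 0 k ^+ 2 =
    \sum_k \sum_l w 0 l / w 0 k * z 0 k ^+ 2 * H ('e k) ('e l).
  apply: eq_bigr => k _; rewrite qE !mulr_suml; apply: eq_bigr => l _.
  by ring.
have Ql : \sum_k q k / w 0 k * z 0 k ^+ 2 =
    \sum_k \sum_l w 0 k / w 0 l * z 0 l ^+ 2 * H ('e k) ('e l).
  rewrite Qk exchange_big/=; apply: eq_bigr => k _; apply: eq_bigr => l _.
  by rewrite (sbC Hsb).
(* Half of the diagonal sum is indexed by [k] and half by [l], to complete the square termwise. *)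
rewrite [X in X - _](_ : _ = 2^-1 * \sum_k q k / w 0 k * z 0 k ^+ 2 +
                             2^-1 * \sum_k q k / w 0 k * z 0 k ^+ 2); last by field.
rewrite {1}Qk Ql Hzz !mulr_sumr -!big_split -sumrB/=; apply: eq_bigr => k _.
rewrite !mulr_sumr -!big_split -sumrB/=; apply: eq_bigr => l _.
by field; rewrite !gt_eqF.
Qed.

Let gap_term_ge0 z k l :
  0 <= 2^-1 * (H ('e k) ('e l) * w 0 k * w 0 l * (z 0 k / w 0 k - z 0 l / w 0 l) ^+ 2).
Proof. have w_ge0 i : 0 <= w 0 i by exact: ltW.
by rewrite mulr_ge0 ?invr_ge0 ?ler0n// mulr_ge0 ?sqr_ge0// !mulr_ge0// H_ge0. Qed.

Let gap_ge0 z : H z z <= \sum_k q k / w 0 k * z 0 k ^+ 2.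
Proof. by rewrite -subr_ge0 gap; do 2!apply: sumr_ge0 => ? _. Qed.

Let q_le_P z k : q k / w 0 k * z 0 k ^+ 2 <= P k * z 0 k ^+ 2.
Proof.
rewrite /P; case: ifPn => //; rewrite -leNgt => qk; rewrite mul1r.
have -> : q k = 0 by apply/eqP; rewrite eq_le qk q_ge0.
by rewrite !mul0r sqr_ge0.
Qed.

Let H_le_P z : H z z <= \sum_k P k * z 0 k ^+ 2.
Proof. by apply: le_trans (gap_ge0 z) _; apply: ler_sum => k _; exact: q_le_P. Qed.

(* The equality case of the Perron-Frobenius inequality [H z z <= z P z]. *)
Let H_eq_P z : \sum_k P k * z 0 k ^+ 2 <= H z z ->
  (forall k, q k = 0 -> z 0 k = 0) /\
  (forall k l, 0 < q k -> 0 < q l -> z 0 k / w 0 k = z 0 l / w 0 l).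
Proof.
move=> PH; split=> [k qk0|].
  have : \sum_k P k * z 0 k ^+ 2 <= \sum_k q k / w 0 k * z 0 k ^+ 2.
    exact: le_trans PH (gap_ge0 z).
  rewrite -subr_le0 -sumrB (bigD1 k)//= {1}/P qk0 ltxx mul1r !mul0r subr0 => h.
  have : 0 <= \sum_(i < m | i != k) (P i * z 0 i ^+ 2 - q i / w 0 i * z 0 i ^+ 2).
    by apply: sumr_ge0 => i _; rewrite subr_ge0.
  have := sqr_ge0 (z 0 k) => z2 s0.
  by apply/eqP; rewrite -sqrf_eq0 eq_le z2 andbT (le_trans _ h)// lerDl.
(* Equality kills every Laplacian term, so [z_k / w_k] is constant along the edges of [H];
   [connected] then spreads this. *)
have edge k l : 0 < H ('e k) ('e l) -> z 0 k / w 0 k = z 0 l / w 0 l.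
  move=> Hkl; have : \sum_k q k / w 0 k * z 0 k ^+ 2 - H z z <= 0.
    rewrite subr_le0; apply: le_trans PH; apply: ler_sum => i _; exact: q_le_P.
  rewrite gap => le0; have /eqP : \sum_k \sum_l 2^-1 * (H ('e k) ('e l) * w 0 k * w 0 l *
      (z 0 k / w 0 k - z 0 l / w 0 l) ^+ 2) = 0.
    by apply/eqP; rewrite eq_le le0; do 2!apply: sumr_ge0 => ? _.
  rewrite psumr_eq0 => [/allP/(_ k (mem_index_enum k))|i _]; last by apply: sumr_ge0.
  rewrite psumr_eq0//= => /allP/(_ l (mem_index_enum l)).
  rewrite mulf_eq0 invr_eq0 pnatr_eq0/= mulf_eq0 sqrf_eq0 subr_eq0.
  rewrite gt_eqF ?mulr_gt0//=.
  by move/eqP.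
move=> k l qk ql; have [->//|[/edge//|[p [/edge -> /edge]]]//] := connected qk ql.
Qed.

(* With [z = P^(-1/2) y] the eigenvalues of [P^(-1/2) H P^(-1/2)] satisfy
   [a <= a^2] by [H_le_sq] and [a <= 1] by [H_le_P]; the eigenvectors for the
   eigenvalue [1] are proportional to [P^(1/2) w]. *)
Lemma hyperbolic_weighted_sum : hyperbolic H.
Proof.
pose s k := Num.sqrt (P k).
have s_gt0 k : 0 < s k by rewrite sqrtr_gt0.
have s2 k : s k ^+ 2 = P k by rewrite sqr_sqrtr// ltW.
pose scl (x : 'rV[R]_m) : 'rV[R]_m := \row_k (x 0 k / s k).
have scl_lin c x y : scl (c *: x + y) = c *: scl x + scl y.
  by apply/rowP => k; rewrite !mxE; ring.
pose N x y := H (scl x) (scl y).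
have Nsb : sym_bilinear N.
  split=> [x y|c x y z]; first exact: (sbC Hsb).
  by rewrite /N scl_lin (sbDl Hsb) (sbZl Hsb).
have sclK x : scl (\row_k (x 0 k * s k)) = x.
  by apply/rowP => k; rewrite !mxE mulfK ?gt_eqF.
suff Nhyp : hyperbolic N.
  move=> a x; have := Nhyp (\row_k (a 0 k * s k)) (\row_k (x 0 k * s k)).
  by rewrite /N !sclK.
have eigen a y : 0 < a -> (forall x, N y x = a * dot y x) -> dot y y = 1 ->
    (forall k, q k = 0 -> y 0 k = 0) /\
    (forall k l, 0 < q k -> 0 < q l -> y 0 k / (s k * w 0 k) = y 0 l / (s l * w 0 l)).
  move=> a0 Ny yy; pose z := scl y.
  have Hez k : H ('e k) z = s k * (a * y 0 k).
    have -> : 'e k = s k *: scl ('e k).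
      apply/rowP => l; rewrite !mxE eqxx/=; case: eqP => [->|_]; last by rewrite mul0r mulr0.
      by rewrite mul1r divff// gt_eqF.
    rewrite (sbZl Hsb) -/(N _ _) (sbC Nsb) Ny; congr (_ * (_ * _)).
    rewrite (bigD1 k)//= big1 => [|l lk]; first by rewrite !mxE !eqxx mulr1 addr0.
    by rewrite !mxE (negPf lk) andbF mulr0.
  have Hzz : H z z = a by rewrite -/(N _ _) Ny yy mulr1.
  have Pz : \sum_k P k * z 0 k ^+ 2 = 1.
    rewrite -yy; apply: eq_bigr => k _; rewrite mxE -s2.
    by field; rewrite gt_eqF.
  have a_ge1 : 1 <= a.
    have := H_le_sq z; rewrite Hzz.
    have -> : \sum_k H ('e k) z ^+ 2 / P k = a ^+ 2.
      rewrite -[RHS]mulr1 -yy mulr_sumr; apply: eq_bigr => k _.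
      by rewrite Hez -s2; field; rewrite gt_eqF.
    by rewrite expr2 ler_pMl.
  have PH : \sum_k P k * z 0 k ^+ 2 <= H z z by rewrite Pz Hzz.
  have [z0 zc] := H_eq_P PH.
  split=> [k /z0|k l qk ql]; first rewrite mxE => /eqP.
    by rewrite mulf_eq0 invr_eq0 (gt_eqF (s_gt0 k)) orbF => /eqP.
  by have := zc k l qk ql; rewrite !mxE !invfM !mulrA.
apply: hyperbolic_eigen => // a b y z a0 b0 Ny Nz yy zz yz.
have [y0 yc] := eigen a y a0 Ny yy; have [z0 zc] := eigen b z b0 Nz zz.
have prop k l : z 0 k * y 0 l = y 0 k * z 0 l.
  have [qk|qk] := ltP 0 (q k); last first.
    have qk0 : q k = 0 by apply/eqP; rewrite eq_le qk q_ge0.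
    by rewrite (y0 k)// (z0 k)// !mul0r.
  have [ql|ql] := ltP 0 (q l); last first.
    have ql0 : q l = 0 by apply/eqP; rewrite eq_le ql q_ge0.
    by rewrite (y0 l)// (z0 l)// !mulr0.
  have swk : s k * w 0 k != 0 by rewrite gt_eqF// mulr_gt0.
  have swl : s l * w 0 l != 0 by rewrite gt_eqF// mulr_gt0.
  have -> : y 0 k = y 0 l / (s l * w 0 l) * (s k * w 0 k).
    by rewrite -(yc k l)// divfK.
  have -> : z 0 k = z 0 l / (s l * w 0 l) * (s k * w 0 k).
    by rewrite -(zc k l)// divfK.
  by ring.
(* By proportionality [y_l = sum_k z_k ^ 2 y_l = (sum_k y_k z_k) z_l], which is zero by
   orthogonality. *)
have yl l : y 0 l = 0.
  rewrite -[LHS]mul1r -zz mulr_suml.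
  rewrite (eq_bigr (fun k => y 0 k * z 0 k * z 0 l)) => [|k _].
    by rewrite -mulr_suml yz mul0r.
  by rewrite -mulrA prop; ring.
have : dot y y = 0 by rewrite big1// => k _; rewrite yl mul0r.
by rewrite yy => /eqP; rewrite oner_eq0.
Qed.

End CubicStep.

(** * Connectedness of M-convex supports *)

Section Connectivity.
Context {I : finType} (J : seq I -> Prop) (d : nat).
Hypothesis J_perm : forall a b, perm_eq a b -> J a -> J b.
Hypothesis J_size : forall a, J a -> size a = d.
Hypothesis J_exchange : seq_Mconvex J.
Hypothesis d_gt1 : (1 < d)%N.

Let dist (a b : seq I) := (\sum_(x : I) (count_mem x a - count_mem x b))%N.

Let dist_exchange a b i j : (count_mem i b < count_mem i a)%N ->
  (count_mem j a < count_mem j b)%N -> (dist (j :: rem i a) b < dist a b)%N.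
Proof.
move=> ib ja; have ia : i \in a by rewrite -has_pred1 has_count (leq_ltn_trans _ ib).
have ij : j != i by apply: contraTneq ja => ->; rewrite -leqNgt ltnW.
have step x : (count_mem x (j :: rem i a) - count_mem x b <=
               count_mem x a - count_mem x b)%N.
  rewrite /= count_rem ia/=; have [<-|xj] := eqVneq j x.
    by rewrite [i == j]eq_sym (negPf ij) subn0 leq_subLR (leq_trans ja)// leq_addr.
  by rewrite add0n leq_sub2r// leq_subr.
rewrite /dist (bigD1 i)//= [leqRHS](bigD1 i)//= -addSn leq_add//;
  last by apply: leq_sum => x _; exact: step.
rewrite count_rem ia/= eqxx (negPf ij) add0n subn1.
by rewrite ltn_sub2r// prednK// (leq_ltn_trans _ ib).
Qed.

(* Take [a] and [b] as close as possible: then they differ by a single exchange. *)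
Lemma Mconvex_connected i j a b : J a -> J b -> i \in a -> j \in b ->
  i = j \/ (exists c, J [:: i, j & c]) \/
  exists p, (exists c, J [:: i, p & c]) /\ (exists c, J [:: p, j & c]).
Proof.
have pair x y c : J c -> x \in c -> y \in c -> x != y -> exists c', J [:: x, y & c'].
  move=> Jc xc yc xy; exists (rem y (rem x c)); apply: J_perm Jc.
  apply: perm_trans (perm_to_rem xc) _; rewrite perm_cons perm_to_rem//.
  have := yc; rewrite (perm_mem (perm_to_rem xc)) inE eq_sym.
  by rewrite (negPf xy).
have [->|ij] := eqVneq i j; first by left.
have [n] := ubnP (dist a b); elim: n a => [//|n IHn] a le_n Ja Jb ia jb.
have [ja|ja] := boolP (j \in a); first by right; left; exact: (pair _ _ a).
have [ib|ib] := boolP (i \in b); first by right; left; exact: (pair _ _ b).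
(* A letter in excess in [a] whose removal leaves an [i] can be exchanged, which brings [a] closer
   to [b]; assume now that there is none. *)
have [[l [lb lia]]|close] := pselect (exists l,
    (count_mem l b < count_mem l a)%N /\ i \in rem l a).
  have [y yb Ja'] := J_exchange Ja Jb lb.
  apply: (IHn (y :: rem l a)) => //; last by rewrite inE lia orbT.
  exact: leq_trans (dist_exchange lb yb) _.
have {}close l : i \in rem l a -> (count_mem l a <= count_mem l b)%N.
  by move=> il; rewrite leqNgt; apply/negP => lb; apply: close; exists l.
have ni : i \notin rem i a.
  apply/negP => ii; have := close i ii.
  by rewrite leqNgt (count_memPn ib) -has_count has_pred1 ia.
(* Since [d > 1], some [p] accompanies [i] in [a]. It is not in excess, so it also occurs in [b],
   next to [j]. *)
have [p pa] : exists p, p \in rem i a.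
  case E : (rem i a) => [|p s]; last by exists p; rewrite mem_head.
  by move: d_gt1; rewrite -(J_size Ja) (perm_size (perm_to_rem ia)) E.
have pi : p != i by apply: contraNneq ni => pi; rewrite -{1}pi.
have pa' : p \in a by apply: mem_rem pa.
have pb : p \in b.
  rewrite -has_pred1 has_count; apply: leq_trans (close p _).
    by rewrite -has_count has_pred1.
  by have := ia; rewrite (perm_mem (perm_to_rem pa')) inE eq_sym (negPf pi).
have pj : p != j by apply: contraNneq ja => <-.
right; right; exists p; split; first by apply: (pair _ _ a) => //; rewrite eq_sym.
exact: (pair _ _ b).
Qed.

End Connectivity.

(** * Multilinear functionals on the orthant *)

Section BasisExpansion.
Context {R : realType} {m : nat}.
Local Notation e := (fun i => delta_mx 0 i : 'rV[R]_m).
Implicit Type T : seq 'rV[R]_m -> R.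

Lemma sm_expand T w s : sym_multilinear T ->
  T (w :: s) = \sum_i w 0 i * T (e i :: s).
Proof.
move=> Tsm; rewrite {1}[w]row_sum_delta sm_sum//.
by apply: eq_bigr => i _; rewrite smZ.
Qed.

Lemma sm_nonneg T ws : sym_multilinear T ->
  (forall a, size a = size ws -> 0 <= T (map e a)) ->
  (forall w : 'rV_m, w \in ws -> forall i, 0 <= w 0 i) -> 0 <= T ws.
Proof.
elim: ws T => [|w ws IHws] T Tsm Tpos wpos; first exact: (Tpos [::]).
rewrite sm_expand//; apply: sumr_ge0 => i _; rewrite mulr_ge0//.
  by apply: wpos; rewrite mem_head.
apply: (IHws (fun s => T (e i :: s))); first exact: sm_cons.
  by move=> a sa; apply: (Tpos (i :: a)); rewrite /= sa.
by move=> v vs; apply: wpos; rewrite inE vs orbT.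
Qed.

(** All terms of the expansion are nonnegative with strictly positive weights, so positivity of the
    sum detects the support. *)
Lemma sm_positive T ws : sym_multilinear T ->
  (forall a, size a = size ws -> 0 <= T (map e a)) ->
  (forall w : 'rV_m, w \in ws -> forall i, 0 < w 0 i) ->
  0 < T ws <-> exists2 a, size a = size ws & 0 < T (map e a).
Proof.
elim: ws T => [|w ws IHws] T Tsm Tpos wpos.
  by split=> [|[a /size0nil->]//]; exists [::].
have w0 : forall i, 0 < w 0 i by apply: wpos; rewrite mem_head.
have {}wpos v : v \in ws -> forall i, 0 < v 0 i.
  by move=> vs; apply: wpos; rewrite inE vs orbT.
have Ti i a : size a = size ws -> 0 <= T (e i :: map e a).
  by move=> sa; apply: (Tpos (i :: a)); rewrite /= sa.
have IH i : 0 < T (e i :: ws) <-> exists2 a, size a = size ws & 0 < T (e i :: map e a).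
  by apply: (IHws (fun s => T (e i :: s))) => //; [exact: sm_cons|exact: Ti].
have nn i : 0 <= T (e i :: ws).
  apply: (@sm_nonneg (fun s => T (e i :: s))); [exact: sm_cons|exact: Ti|].
  by move=> v vs k; rewrite ltW// wpos.
rewrite sm_expand//; split=> [pos|[[//|i a] [sa] Ta]].
  have /existsP[i Twi] : [exists i, 0 < T (e i :: ws)].
    apply: contraLR pos; rewrite negb_exists => /forallP h; rewrite -leNgt.
    by apply: sumr_le0 => i _; rewrite mulr_ge0_le0 ?(ltW (w0 i))// leNgt h.
  by have /IH[a sa Ta] := Twi; exists (i :: a); rewrite //= sa.
rewrite (bigD1 i)//= ltr_pwDl//; first by rewrite mulr_gt0//; apply/IH; exists a.
by apply: sumr_ge0 => j _; rewrite mulr_ge0// ltW.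
Qed.

(* The polynomial with polarization [T] has nonnegative coefficients, M-convex
   support and second derivatives of hyperbolic signature in the basis directions. *)
Lemma hyperbolic_nonneg_directions k T : sym_multilinear T ->
  (forall a, size a = k.+2 -> 0 <= T (map e a)) ->
  seq_Mconvex (fun a => size a = k.+2 /\ 0 < T (map e a)) ->
  (forall a, size a = k -> hyperbolic (fun x y => T [:: x, y & map e a])) ->
  forall ws, size ws = k -> (forall w : 'rV_m, w \in ws -> forall i, 0 <= w 0 i) ->
    hyperbolic (fun x y => T [:: x, y & ws]).
Proof.
elim: k T => [|k IHk] T Tsm Tpos TM Thyp.
  by move=> ws /size0nil -> _; exact: (Thyp [::]).
(* Adding multiples of the all-ones vector reduces to strictly positive coordinates. *)
apply: (@hyperbolic_closure _ _ _ Tsm [set w : 'rV_m | forall i, 0 < w 0 i]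
  [set w : 'rV_m | forall i, 0 <= w 0 i] (const_mx 1)).
  by move=> v c v0 c0 i; rewrite !mxE mulr1 ltr_wpDl.
move=> [//|w ws] [sws] wpos.
have w0 : forall i, 0 < w 0 i by apply: wpos; rewrite mem_head.
have {}wpos v : v \in ws -> forall i, 0 < v 0 i.
  by move=> vs; apply: wpos; rewrite inE vs orbT.
have pC l v r : T (l ++ v :: r) = T (v :: l ++ r).
  by apply: Tsm.1; rewrite -[v :: r]cat1s perm_catCA.
have Tsm' i : sym_multilinear (fun s => T (e i :: s)) by exact: sm_cons.
have wpos' v : v \in ws -> forall i, 0 <= v 0 i by move=> vs i; rewrite ltW// wpos.
pose B i x y := T [:: e i, x, y & ws].
have Bsb i : sym_bilinear (B i) by exact: (sm_bilinear ws (Tsm' i)).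
have Tw x y : T [:: x, y, w & ws] = \sum_i w 0 i * B i x y.
  rewrite (pC [:: x; y]) sm_expand//.
suff hyp : hyperbolic (fun x y => \sum_i w 0 i * B i x y).
  by move=> a x; rewrite !Tw; exact: hyp.
have posB v : v \in w :: ws -> forall i, 0 < v 0 i.
  by move=> vs i; move: vs; rewrite inE => /predU1P[->|/wpos].
have expH i j : 0 < T [:: e i, e j, w & ws] <->
    exists c, size [:: i, j & c] = k.+3 /\ 0 < T (map e [:: i, j & c]).
  have := @sm_positive (fun s => T ([:: e i; e j] ++ s)) (w :: ws) (sm_cat _ Tsm).
  rewrite /= sws => h; split=> [/h[]//|[c [[sc] Tc]]].
  - by move=> a sa; apply: (Tpos [:: i, j & a]); rewrite /= sa.
  - by move=> a sa Ta; exists a; rewrite sa.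
  - by apply/h => //; [move=> a sa; apply: (Tpos [:: i, j & a]); rewrite /= sa | exists c].
have expq i : 0 < T [:: e i, w, w & ws] ->
    exists a, (size a = k.+3 /\ 0 < T (map e a)) /\ i \in a.
  have := @sm_positive (fun s => T (e i :: s)) [:: w, w & ws] (Tsm' i).
  rewrite /= sws => h /h[]//.
  - by move=> a sa; apply: (Tpos (i :: a)); rewrite /= sa.
  - by move=> v; rewrite inE => /predU1P[->|/posB].
  - by move=> a sa Ta; exists (i :: a); rewrite /= sa mem_head.
apply: hyperbolic_weighted_sum => //.
- move=> i; apply: (IHk (fun s => T (e i :: s))) => //.
  + by move=> a sa; apply: (Tpos (i :: a)); rewrite /= sa.
  (* Prepending [i] to both lists preserves differences of multiplicities, so the support of
     [T (e_i, ...)] inherits the exchange property. *)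
  + move=> a b [sa Ta] [sb Tb] j jba.
    have [] := TM (i :: a) (i :: b) _ _ j; rewrite /= ?sa ?sb ?ltn_add2l//.
    move=> l lab [sl Tl]; exists l; first by move: lab; rewrite ltn_add2l.
    have ja : j \in a by rewrite -has_pred1 has_count (leq_ltn_trans _ jba).
    split; first by rewrite /= size_rem// sa.
    rewrite -(Tsm.1 (map e (l :: rem j (i :: a))))//.
    rewrite -!map_cons perm_map//= -[[:: i, l & _]]/([:: i] ++ [:: l] ++ _).
    rewrite perm_sym perm_catCA perm_cons perm_sym.
    by case: eqVneq => // ->; rewrite perm_to_rem.
  + move=> a sa b x; have := Thyp (i :: a); rewrite /= sa => /(_ erefl b x).
    have sw u v : T [:: u, v, e i & map e a] = T [:: e i, u, v & map e a].
      exact: (pC [:: u; v]).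
    by rewrite !sw.
- by move=> i j z; exact: (pC [:: e j]).
- move=> l i j; apply: (@sm_nonneg (fun s => T ([:: e l; e i; e j] ++ s))) => //.
    exact: sm_cat.
  by move=> a sa; apply: (Tpos [:: l, i, j & a]); rewrite /= sa sws.
- move=> i j; rewrite -!Tw => qi qj.
  have [a [[sa Ta] ia]] := expq i qi; have [b [[sb Tb] jb]] := expq j qj.
  have [] := @Mconvex_connected _ (fun a => size a = k.+3 /\ 0 < T (map e a)) k.+3
    _ _ TM _ i j a b => //.
  + by move=> s t st [<- Ts]; rewrite -(perm_size st) -(Tsm.1 _ _ (perm_map _ st)).
  + by move=> s [].
  + by left.
  + move=> [[c Jc]|[p [[c Jc] [c' Jc']]]]; right.
      by left; have := (expH i j).2 (ex_intro _ c Jc); rewrite Tw.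
    right; exists p; have := (expH i p).2 (ex_intro _ c Jc); rewrite Tw => ip.
    by have := (expH p j).2 (ex_intro _ c' Jc'); rewrite Tw.
Qed.

End BasisExpansion.

(** * Convex cones *)

Section Minkowski.
Context {R : realType} {n : nat} (C : set 'rV[R]_n).
Hypothesis C0 : C 0.
Hypothesis CD : forall x y, C x -> C y -> C (x + y).
Hypothesis CZ : forall (c : R) x, 0 <= c -> C x -> C (c *: x).
Hypothesis C_ray_closed : forall a b, (forall e : R, 0 < e -> C (a + e *: b)) -> C a.
Hypothesis C_pointed : pointed C.

Definition conic_span (S : set 'rV[R]_n) : set 'rV[R]_n :=
  [set v | exists m (E : 'M[R]_(m, n)) (w : 'rV[R]_m),
    [/\ forall i, S (row i E), forall i, 0 <= w 0 i & v = w *m E]].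

Definition unit_extreme_ray : set 'rV[R]_n :=
  [set u : 'rV[R]_n | \sum_(i < n) u 0 i ^+ 2 = 1 /\ extreme_ray C (ray u)].

Let conic := conic_span unit_extreme_ray.

Lemma row_col_mx (S : set 'rV[R]_n) m1 m2 (E1 : 'M[R]_(m1, n)) (E2 : 'M[R]_(m2, n)) :
  (forall i, S (row i E1)) -> (forall i, S (row i E2)) ->
  forall i, S (row i (col_mx E1 E2)).
Proof.
move=> S1 S2 i; case: (splitP i) => j ij.
  have -> : i = lshift m2 j by apply/val_inj.
  by rewrite rowKu.
have -> : i = rshift m1 j by apply/val_inj.
by rewrite rowKd.
Qed.

Let conic0 : conic 0.
Proof.
by exists 0, 0, 0; split; [case|case|rewrite mul0mx].
Qed.

Let conicD x y : conic x -> conic y -> conic (x + y).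
Proof.
move=> [m1 [E1 [w1 [S1 p1 ->]]]] [m2 [E2 [w2 [S2 p2 ->]]]].
exists (m1 + m2), (col_mx E1 E2), (row_mx w1 w2); split.
- exact: row_col_mx.
- by move=> i; rewrite mxE; case: splitP.
- by rewrite mul_row_col.
Qed.

Let conicZ c x : 0 <= c -> conic x -> conic (c *: x).
Proof.
move=> c0 [m [E [w [S1 p1 ->]]]]; exists m, E, (c *: w); split => //.
  by move=> i; rewrite mxE mulr_ge0.
by rewrite scalemxAl.
Qed.

Let conic_unit u : unit_extreme_ray u -> conic u.
Proof.
move=> Su; exists 1, u, 1%:M; split; last by rewrite mul1mx.
  by move=> i; rewrite (_ : row i u = u)//; apply/rowP => j; rewrite mxE ord1.
by move=> i; rewrite ord1 mxE.
Qed.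

(* The linear span of the smallest face containing [v]. *)
Let face (v : 'rV[R]_n) : set 'rV[R]_n :=
  [set x | exists2 e, 0 < e & C (v + e *: x) /\ C (v - e *: x)].

Let face_shrink v x e e' : C v -> 0 < e -> 0 <= e' -> e' <= e ->
  C (v + e *: x) -> C (v + e' *: x).
Proof.
move=> Cv e0 e'0 le Cx.
have -> : v + e' *: x = (1 - e' / e) *: v + (e' / e) *: (v + e *: x).
  by apply/rowP => j; rewrite !mxE; field; rewrite gt_eqF.
apply: CD; apply: CZ => //; last by rewrite divr_ge0// ltW.
by rewrite subr_ge0 ler_pdivrMr// mul1r.
Qed.

Let face_id v : C v -> face v v.
Proof.
by move=> Cv; exists 1 => //; rewrite scale1r subrr; split; [exact: CD|].
Qed.

Let faceN v x : face v x -> face v (- x).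
Proof. by move=> [e e0 [h1 h2]]; exists e => //; rewrite scalerN opprK. Qed.

Let faceD v x y : C v -> face v x -> face v y -> face v (x + y).
Proof.
move=> Cv [e e0 [x1 x2]] [f f0 [y1 y2]].
pose g := Num.min e f; have g0 : 0 < g by rewrite lt_min e0.
have ge : g <= e by rewrite ge_min lexx.
have gf : g <= f by rewrite ge_min lexx orbT.
have half u u' : C (v + g *: u) -> C (v + g *: u') -> C (v + g / 2 *: (u + u')).
  move=> h h'; have -> : v + g / 2 *: (u + u') = 2^-1 *: ((v + g *: u) + (v + g *: u')).
    by apply/rowP => j; rewrite !mxE; field.
  by apply: CZ; [rewrite invr_ge0|exact: CD].
exists (g / 2); first by rewrite divr_gt0.
rewrite -scalerN opprD; rewrite -!scalerN in x2 y2.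
by split; apply: half; [apply: face_shrink ge x1|apply: face_shrink gf y1|
  apply: face_shrink ge x2|apply: face_shrink gf y2] => //; exact: ltW.
Qed.

Let faceZ v c x : C v -> face v x -> face v (c *: x).
Proof.
move=> Cv [e e0 [h1 h2]]; have [->|c0] := eqVneq c 0.
  by exists 1 => //; rewrite scale0r scaler0 subr0 addr0.
exists (e / `|c|); first by rewrite divr_gt0// normr_gt0.
rewrite scalerA; have [cp|cn] := ltP 0 c.
  by rewrite gtr0_norm// divfK.
rewrite ler0_norm// invrN mulrN mulNr divfK// scaleNr opprK.
by split.
Qed.

Let face_sub v y c : 0 < c -> C (v - c *: y) -> face y `<=` face v.
Proof.
move=> c0 Cr x [e e0 [h1 h2]]; exists (c * e); first by rewrite mulr_gt0.
have E z : v + (c * e) *: z = (v - c *: y) + c *: (y + e *: z).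
  by rewrite scalerDr scalerA addrA subrK.
rewrite -scalerN !E; split; apply: CD => //; apply: CZ; rewrite ?ltW//.
by rewrite scalerN.
Qed.

(** A face is given only as a set of vectors, so its dimension is bounded through the row spaces
    contained in it. *)
Let face_dim_le (v : 'rV[R]_n) k := forall A : 'M[R]_n,
  (forall x : 'rV_n, (x <= A)%MS -> face v x) -> (\rank A <= k)%N.

(** The face of [y] is contained in that of [v]; adjoining [v], which is not in the face of [y],
    raises the rank. *)
Let face_dim_lt v y c k : C v -> C y -> 0 < c -> C (v - c *: y) -> ~ face y v ->
  face_dim_le v k.+1 -> face_dim_le y k.
Proof.
move=> Cv Cy c0 Cr yv vk A Ay; rewrite -ltnS.
have : (A < addsmx A v)%MS.
  rewrite ltmxE addsmxSl/=; apply/negP => h; apply/yv/Ay.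
  exact: submx_trans (addsmxSr A v) h.
move=> /rank_ltmx lt; apply: leq_trans lt _.
have -> : \rank (addsmx A v) = \rank <<addsmx A v>>%MS by rewrite genmxE.
apply: vk => x; rewrite genmxE => /sub_addsmxP[[a b] ->] /=.
apply: faceD => //; first by apply/(face_sub c0 Cr)/Ay; exact: submxMl.
by rewrite [b]mx11_scalar mul_scalar_mx; apply: faceZ => //; exact: face_id.
Qed.

(** Pointedness bounds the admissible [s] from below, since otherwise [- v] would be in [C];
    closedness along lines makes the infimum admissible. *)
Let faceN_bound v x : C v -> v != 0 -> face v x ->
  exists s, C (s *: v - x) /\ forall t, C (t *: v - x) -> s <= t.
Proof.
move=> Cv v0 [e e0 [h1 h2]]; pose S := [set s | C (s *: v - x)].
have Cx1 : C (e^-1 *: v - x).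
  have -> : e^-1 *: v - x = e^-1 *: (v - e *: x).
    by rewrite scalerBr scalerA mulVf ?scale1r ?gt_eqF.
  by apply: CZ => //; rewrite invr_ge0 ltW.
have Cx2 : C (e^-1 *: v + x).
  have -> : e^-1 *: v + x = e^-1 *: (v + e *: x).
    by rewrite scalerDr scalerA mulVf ?scale1r ?gt_eqF.
  by apply: CZ => //; rewrite invr_ge0 ltW.
have lb : lbound S (- e^-1).
  move=> s Ss; rewrite leNgt; apply/negP => lt.
  have Cs : C ((s + e^-1) *: v).
    by rewrite scalerDl -(subrK x (s *: v)) -addrA [x + _]addrC; exact: CD.
  have c0 : 0 < - (s + e^-1) by lra.
  have CNv : C (- v).
    have -> : - v = (- (s + e^-1))^-1 *: ((s + e^-1) *: v).
      by rewrite scalerA invrN mulNr mulVf ?scaleN1r// -oppr_eq0 gt_eqF.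
    by apply: CZ => //; rewrite invr_ge0 ltW.
  by move: v0; rewrite (C_pointed Cv CNv) eqxx.
have Sinf : has_inf S by split; [exists e^-1|exists (- e^-1)].
exists (inf S); split; last by move=> t; apply: ge_inf; exists (- e^-1).
apply: (@C_ray_closed _ v) => d d0; have [s Ss lt] := inf_adherent d0 Sinf.
have -> : inf S *: v - x + d *: v = (inf S + d - s) *: v + (s *: v - x).
  by apply/rowP => j; rewrite !mxE; ring.
by apply: CD => //; apply: CZ => //; rewrite subr_ge0 ltW.
Qed.

(** Summands of a positive multiple of [v] lie in the face of [v], hence on its line, and
    pointedness makes their coefficients nonnegative; so the normalized [v] is extreme. *)
Let unit_extreme_of_line v : C v -> v != 0 ->
  (forall x, face v x -> exists c, x = c *: v) -> conic v.
Proof.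
move=> Cv v0 line.
have N0 : 0 < \sum_i v 0 i ^+ 2.
  rewrite lt_neqAle sumr_ge0 ?andbT => [|i _]; last exact: sqr_ge0.
  rewrite eq_sym psumr_eq0 => [|i _]; last exact: sqr_ge0.
  apply: contra v0 => /allP h; apply/eqP/rowP => i; rewrite mxE.
  by have := h i (mem_index_enum i); rewrite sqrf_eq0 => /eqP.
pose l := Num.sqrt (\sum_i v 0 i ^+ 2).
have l0 : 0 < l by rewrite sqrtr_gt0.
pose u := l^-1 *: v.
have vE : v = l *: u by rewrite scalerA divff ?scale1r ?gt_eqF.
rewrite vE; apply: conicZ; first exact: ltW.
apply: conic_unit; split.
  under eq_bigr do rewrite mxE exprMn; rewrite -mulr_sumr.
  by rewrite exprVn sqr_sqrtr ?mulVf ?gt_eqF// ltW.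
have rayv x : ray u x <-> exists2 c, 0 <= c & x = c *: v.
  split=> [[c /= c0 <-]|[c c0 ->]].
    by exists (c / l); rewrite ?divr_ge0 ?(ltW l0)// scalerA.
  by exists (c * l); rewrite /= ?mulr_ge0 ?(ltW l0)// scalerA mulfK// gt_eqF.
have half x y c : 0 <= c -> C x -> C y -> x + y = c *: v -> ray u x.
  rewrite le_eqVlt => /predU1P[<-|c0] Cx Cy xy; apply/rayv.
    exists 0 => //; rewrite scale0r; apply: C_pointed => //.
    by move/eqP: xy; rewrite scale0r addrC addr_eq0 => /eqP <-.
  have : face v x.
    exists c^-1; first by rewrite invr_gt0.
    have vE' : v = c^-1 *: (x + y) by rewrite xy scalerA mulVf ?scale1r ?gt_eqF.
    have ci : 0 <= c^-1 by rewrite invr_ge0 ltW.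
    split; first by apply: CD => //; exact: CZ.
    by rewrite {1}vE' scalerDr addrAC subrr add0r; exact: CZ.
  move=> /line[a xE]; exists a => //; rewrite leNgt; apply/negP => a0.
  have CNv : C (- v).
    have -> : - v = (- a)^-1 *: x by rewrite xE scalerA invrN mulNr mulVf ?scaleN1r ?lt_eqF.
    by apply: CZ => //; rewrite invr_ge0 oppr_ge0 ltW.
  by move: v0; rewrite (C_pointed Cv CNv) eqxx.
split=> [x /rayv[c c0 ->]|x y Cx Cy /rayv[c c0 xy]]; first exact: CZ.
by split; [apply: half xy|apply: half (etrans (addrC y x) xy)].
Qed.

(* If the face of [v] contains a direction [x] transverse to [v], the lines
   through [v] leave [C] after meeting lower-dimensional faces on both sides:
   [v] is a positive combination of [s *: v - x] and [t *: v + x] for the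
   least admissible [s] and [t]. *)
Theorem Minkowski_cone v : C v -> conic v.
Proof.
suff main k : forall v, C v -> face_dim_le v k -> conic v.
  by move=> Cv; apply: (main n v Cv) => A _; exact: rank_leq_row.
elim: k => [|k IHk] {}v Cv dim.
  have : (\rank <<v>>%MS <= 0)%N.
    apply: dim => x; rewrite genmxE => /sub_rVP[c ->].
    by apply: faceZ => //; exact: face_id.
  by rewrite genmxE leqn0 mxrank_eq0 => /eqP ->.
have [->//|v0] := eqVneq v 0.
have [[x [fx xv]]|line] := pselect (exists x, face v x /\ forall c, x <> c *: v); last first.
  apply: unit_extreme_of_line => // x fx.
  have [//|nc] := pselect (exists c, x = c *: v).
  by exfalso; apply: line; exists x; split=> // c xc; apply: nc; exists c.
have [s [Cs sle]] := faceN_bound Cv v0 fx.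
have [t [Ct tle]] := faceN_bound Cv v0 (faceN fx).
rewrite opprK in Ct.
set y := s *: v - x in Cs; set z := t *: v + x in Ct.
have yz : y + z = (s + t) *: v by apply/rowP => j; rewrite !mxE; ring.
have st : 0 < s + t.
  (* If [s + t = 0], pointedness gives [y = 0] and [x] is a multiple of [v]; if [s + t < 0], then
     [- v] is in [C]. *)
  rewrite ltNge; apply/negP; rewrite le_eqVlt => /predU1P[st0|st0].
    apply: (xv s); apply/eqP; rewrite eq_sym -subr_eq0; apply/eqP/C_pointed => //.
    move/eqP: yz; rewrite st0 scale0r addr_eq0 => /eqP yE.
    by rewrite -/y yE opprK.
  have CNv : C (- v).
    have -> : - v = (- (s + t))^-1 *: (y + z).
      by rewrite yz scalerA invrN mulNr mulVf ?scaleN1r// lt_eqF.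
    by apply: CZ; [rewrite invr_ge0 oppr_ge0 ltW|exact: CD].
  by move: v0; rewrite (C_pointed Cv CNv) eqxx.
have vE : v = (s + t)^-1 *: (y + z) by rewrite yz scalerA mulVf ?scale1r ?gt_eqF.
have c0 : 0 < (s + t)^-1 by rewrite invr_gt0.
rewrite vE; apply: conicZ; first exact: ltW.
apply: conicD; apply: IHk => //.
  apply: (@face_dim_lt v y _ k Cv Cs c0) => //.
    by rewrite {1}vE scalerDr addrAC subrr add0r; apply: CZ => //; exact: ltW.
  (* Minimality of [s] keeps [v] out of the face of [y]. *)
  move=> [e e0 [_ Ce]]; have : s <= s - e.
    by apply: sle; move: Ce; rewrite /y scalerBl addrAC.
  by lra.
apply: (@face_dim_lt v z _ k Cv Ct c0) => //.
  by rewrite {1}vE scalerDr -addrA subrr addr0; apply: CZ => //; exact: ltW.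
move=> [e e0 [_ Ce]]; have : t <= t - e.
  by apply: tle; move: Ce; rewrite /z scalerBl addrAC opprK.
by lra.
Qed.

End Minkowski.

Section ConicSpan.
Context {R : realType} {n : nat} (S : set 'rV[R]_n).

(** Common generators, padded with zero coefficients, allow all arguments of a polarization to be
    pulled back to one orthant. *)
Lemma conic_span_common (vs : seq 'rV[R]_n) : (forall v, v \in vs -> conic_span S v) ->
  exists m (E : 'M[R]_(m, n)), (forall i, S (row i E)) /\
    forall v, v \in vs -> exists2 w : 'rV[R]_m, (forall i, 0 <= w 0 i) & v = w *m E.
Proof.
elim: vs => [|v vs IHvs] Cvs; first by exists 0, 0; split; first by case.
have [|m1 [E1 [S1 h1]]] := IHvs.
  by move=> x xs; apply: Cvs; rewrite inE xs orbT.
have [m2 [E2 [w2 [S2 w2p vE]]]] := Cvs v (mem_head _ _).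
exists (m1 + m2)%N, (col_mx E1 E2); split; first exact: row_col_mx.
move=> x; rewrite inE => /predU1P[->|/h1[w wp ->]].
  exists (row_mx 0 w2); last by rewrite mul_row_col mul0mx add0r.
  by move=> i; rewrite mxE; case: splitP => j _ //; rewrite mxE.
exists (row_mx w 0); last by rewrite mul_row_col mul0mx addr0.
by move=> i; rewrite mxE; case: splitP => j _ //; rewrite mxE.
Qed.

End ConicSpan.

Lemma ball_line (R : realType) n (v b : 'rV[R]_n) e : 0 < e ->
  exists2 t, 0 < t & ball v e (v + t *: b).
Proof.
move=> e0; pose M := \sum_i `|b 0 i| + 1.
have M0 : 0 < M by rewrite ltr_wpDl// sumr_ge0.
exists (e / M / 2); first by rewrite !divr_gt0.
split=> //= i j; rewrite /ball/= ord1 !mxE opprD addrA subrr add0r.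
rewrite normrN normrM gtr0_norm ?divr_gt0//.
have bM : `|b 0 j| <= M.
  by rewrite /M (bigD1 j)//= -addrA lerDl addr_ge0// sumr_ge0.
apply: (@le_lt_trans _ _ (e / M / 2 * M)); first by rewrite ler_pM2l ?divr_gt0.
have -> : e / M / 2 * M = e / 2 by field; rewrite gt_eqF.
by rewrite gtr_pMr// invf_lt1 ?ltr1n.
Qed.

(** * Open convex cones and their closures *)

Section OpenConvexCone.
Context {R : realType} {n : nat} (K : set 'rV[R]_n).
Hypothesis K_cone : open_convex_cone K.

Let KZ c x : 0 < c -> K x -> K (c *: x).
Proof. by case: K_cone => _ _ _; apply. Qed.

Let KD x y : K x -> K y -> K (x + y).
Proof.
move=> Kx Ky; have [_ _ Kconv _] := K_cone.
have h : (2^-1 : R) <= 1 by rewrite invf_le1 ?ler1n.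
have h0 : 0 <= (2^-1 : R) by rewrite invr_ge0.
have := Kconv x y (interval_inference.Itv01 h0 h) (mem_set Kx) (mem_set Ky).
move=> /set_mem /(KZ (ltr0n R 2)).
rewrite -[convex.conv _ _ _]/(2^-1 *: x + (1 - 2^-1) *: y).
by congr K; apply/rowP => j; rewrite !mxE; field.
Qed.

Lemma openK_line k b : K k -> exists2 t, 0 < t & K (k + t *: b).
Proof.
have [_ Ko _ _] := K_cone; move: Ko; rewrite openE => /(_ k) h /h.
rewrite /interior/= -nbhs_ballE => -[e /= e0 eK].
by have [t t0 /eK] := ball_line k b e0; exists t.
Qed.

(** Approximate [v] by [x] in [K]; openness at [k] absorbs the error [v - x]. *)
Lemma closure_addK v k : closure K v -> K k -> K (v + k).
Proof.
have [_ Ko _ _] := K_cone; move: Ko; rewrite openE => /(_ k) h Cv /h.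
rewrite /interior/= -nbhs_ballE => -[e /= e0 eK].
have [x [Kx vx]] := Cv (ball v e) (nbhsx_ballx _ _ e0).
have -> : v + k = x + (k + (v - x)) by apply/rowP => j; rewrite !mxE; ring.
apply: KD => //; apply: eK; split=> //= i j.
have [_ /(_ i j)] := vx; rewrite /ball/= => h'.
by rewrite !mxE opprD addrA subrr add0r normrN.
Qed.

(** Together with [closure_addK] this reduces closure properties to properties of [K]. *)
Lemma closureK_limit v k : (forall e, 0 < e -> K (v + e *: k)) -> closure K v.
Proof.
move=> vk B; rewrite -nbhs_ballE => -[e /= e0 eB].
have [t t0 /eB] := ball_line v k e0.
by exists (v + t *: k); split=> //; exact: vk.
Qed.

Lemma closureK0 : closure K 0.
Proof.
have [[k Kk] _ _ _] := K_cone; apply: (@closureK_limit _ k) => e e0.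
by rewrite add0r; exact: KZ.
Qed.

Lemma closureKD x y : closure K x -> closure K y -> closure K (x + y).
Proof.
have [[k Kk] _ _ _] := K_cone => Cx Cy; apply: (@closureK_limit _ k) => e e0.
by rewrite -addrA; apply/closure_addK/closure_addK/KZ.
Qed.

Lemma closureKZ c x : 0 <= c -> closure K x -> closure K (c *: x).
Proof.
have [[k Kk] _ _ _] := K_cone; rewrite le_eqVlt => /predU1P[<- _|c0 Cx].
  by rewrite scale0r; exact: closureK0.
apply: (@closureK_limit _ k) => e e0.
have -> : c *: x + e *: k = c *: (x + (c^-1 * e) *: k).
  by rewrite scalerDr scalerA mulVKf// gt_eqF.
by apply/KZ/closure_addK/KZ => //; rewrite mulr_gt0 ?invr_gt0.
Qed.

Lemma closureK_ray a b : (forall e, 0 < e -> closure K (a + e *: b)) -> closure K a.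
Proof.
have [[k Kk] _ _ _] := K_cone => ab; apply: (@closureK_limit _ k) => e e0.
have [t t0 Kt] := openK_line (- b) (KZ e0 Kk).
have -> : a + e *: k = (a + t *: b) + (e *: k + t *: - b).
  by rewrite scalerN addrACA subrr addr0.
by apply: closure_addK => //; exact: ab.
Qed.

Lemma closureK_conic : pointed (closure K) ->
  forall v, closure K v -> conic_span (unit_extreme K) v.
Proof.
move=> Kp v Cv; apply: (@Minkowski_cone _ _ (closure K)) => //.
- exact: closureK0.
- exact: closureKD.
- exact: closureKZ.
- exact: closureK_ray.
Qed.

Lemma openK_spans x : exists k1 k2, [/\ K k1, K k2 & exists2 c, 0 < c & c *: x = k1 - k2].
Proof.
have [[k Kk] _ _ _] := K_cone; have [t t0 Kt] := openK_line x Kk.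
exists (k + t *: x), k; split=> //; exists t => //.
by rewrite addrAC subrr add0r.
Qed.

End OpenConvexCone.

(** * Lorentzian polynomials *)

Section Polarization.
Context {R : realType} {n : nat}.
Implicit Types (f g : {mpoly R[n]}) (u v : 'rV[R]_n).

Lemma dirderivC u v f : dirderiv u (dirderiv v f) = dirderiv v (dirderiv u f).
Proof.
have E x y : dirderiv x (dirderiv y f) =
    \sum_i \sum_j (x 0 i * y 0 j) *: mderiv i (mderiv j f).
  apply: eq_bigr => i _; rewrite /dirderiv [mderiv i _]linear_sum /= scaler_sumr.
  by apply: eq_bigr => j _; rewrite mderivZ scalerA.
rewrite !E exchange_big/=; apply: eq_bigr => i _; apply: eq_bigr => j _.
by congr (_ *: _); [exact: mulrC|exact: mderiv_comm].
Qed.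

Lemma dirderivs_perm s t f : perm_eq s t -> dirderivs s f = dirderivs t f.
Proof.
have front x l r : dirderivs (l ++ x :: r) f = dirderiv x (dirderivs (l ++ r) f).
  by elim: l => //= y l ->; rewrite dirderivC.
elim: s t => [|x s IHs] t st.
  by move: st; rewrite perm_sym => /perm_nilP ->.
have xt : x \in t by rewrite -(perm_mem st) mem_head.
case/splitPr: xt st => l r st; rewrite front /=; congr (dirderiv _ _); apply: IHs.
by rewrite -(perm_cons x) (perm_trans st)// -[x :: r]cat1s perm_catCA.
Qed.

Definition polarization f (s : seq 'rV[R]_n) : R := mconst (dirderivs s f).

Lemma polarization_multilinear f : sym_multilinear (polarization f).
Proof.
split=> [s t st|c x y s]; first by rewrite /polarization (dirderivs_perm f st).
rewrite /polarization /mconst /= -mcoeffZ -mcoeffD; congr (_@_ _).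
rewrite /dirderiv scaler_sumr -big_split/=; apply: eq_bigr => i _.
by rewrite !mxE scalerDl scalerA.
Qed.

(** [k] collects the factors produced by differentiating; only its positivity matters. *)
Lemma mcoeff_foldr_mderiv f (a : seq 'I_n) m : exists2 k,
  (0 < k)%N & (foldr (@mderiv n R) f a)@_m = f@_(m + \sum_(i <- a) U_(i))%MM *+ k.
Proof.
elim: a m => [|i a IHa] m; first by exists 1%N; rewrite ?big_nil ?addm0.
have [k k0 E] := IHa (m + U_(i))%MM.
exists (k * (m i).+1)%N; first by rewrite muln_gt0 k0.
by rewrite /= mcoeff_mderiv E big_cons -mulrnA addmA.
Qed.

Definition mnm_seq m (alpha : 'X_{1..m}) : seq 'I_m :=
  flatten [seq nseq (alpha i) i | i <- enum 'I_m].

Lemma count_mnm_seq m (alpha : 'X_{1..m}) j : count_mem j (mnm_seq alpha) = alpha j.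
Proof.
rewrite /mnm_seq count_flatten -map_comp sumnE big_map big_enum/= (bigD1 j)//=.
rewrite count_nseq /= eqxx mul1n big1 ?addn0// => i ij.
by rewrite count_nseq/= (negPf ij).
Qed.

Lemma size_mnm_seq m (alpha : 'X_{1..m}) : size (mnm_seq alpha) = mdeg alpha.
Proof.
rewrite /mnm_seq size_flatten /shape -map_comp sumnE big_map big_enum/= mdegE.
by apply: eq_bigr => i _; rewrite size_nseq.
Qed.

Lemma perm_mnm_seq m (alpha : 'X_{1..m}) s :
  (forall i, alpha i = count_mem i s) -> perm_eq (mnm_seq alpha) s.
Proof. by move=> h; apply/allP => i _ /=; rewrite count_mnm_seq h. Qed.

Lemma sum_mnm_seq m (alpha : 'X_{1..m}) : (\sum_(i <- mnm_seq alpha) U_(i))%MM = alpha.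
Proof.
apply/mnmP => j; rewrite mnm_sumE -[RHS]count_mnm_seq -sum1_count [RHS]big_mkcond/=.
by apply: eq_bigr => i _; rewrite mnm1E; case: eqP.
Qed.

Lemma dirderivX_mnm_seq m (u : m.-tuple 'rV[R]_n) alpha f :
  dirderivX u alpha f = dirderivs (map (tnth u) (mnm_seq alpha)) f.
Proof.
rewrite /dirderivX /mnm_seq; elim: (enum _) => //= i r ->.
rewrite map_cat map_nseq /dirderivs foldr_cat.
by elim: (alpha i) => //= k ->.
Qed.

(** Differentiating along the leading monomial isolates its coefficient, up to a positive
    integer. *)
Lemma polarization_neq0 d f : f \is d.-homog -> f != 0 ->
  exists2 s, size s = d & polarization f s != 0.
Proof.
move=> fh f0; pose m := mlead f.
have md : mdeg m = d by move/dhomogP: fh; apply; exact: mlead_supp.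
exists [seq delta_mx 0 i | i <- mnm_seq m]; first by rewrite size_map size_mnm_seq.
have dE g i : dirderiv (delta_mx 0 i) g = mderiv i g.
  rewrite /dirderiv (bigD1 i)//= big1 => [|j ji]; first by rewrite mxE !eqxx scale1r addr0.
  by rewrite mxE (negPf ji) andbF scale0r.
have -> : polarization f [seq delta_mx 0 i | i <- mnm_seq m] =
    (foldr (@mderiv n R) f (mnm_seq m))@_0%MM.
  rewrite /polarization /mconst; congr (_@_ _).
  by elim: (mnm_seq m) => //= i s ->.
have [k k0 ->] := mcoeff_foldr_mderiv f (mnm_seq m) 0%MM.
by rewrite add0m sum_mnm_seq mulrn_eq0 negb_or -lt0n k0 mleadc_eq0.
Qed.

End Polarization.

(** * From nonnegativity to strict positivity on an open cone *)

Section Positivity.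
Context {R : realType} {n : nat} {K : set 'rV[R]_n} (K_cone : open_convex_cone K).
Context (T : seq 'rV[R]_n -> R) (Tsm : sym_multilinear T) (d : nat).
Hypothesis T_ge0 : forall s, size s = d -> (forall x, x \in s -> K x) -> 0 <= T s.

Let T_moveC l v r : T (l ++ v :: r) = T (v :: l ++ r).
Proof. by apply: Tsm.1; rewrite -[v :: r]cat1s perm_catCA. Qed.

(** A linear functional that is nonnegative on an open cone and zero at one of its points vanishes,
    since one can move from that point along both [x] and [- x]. *)
Let T_eq0_head v x r : (size r).+1 = d -> K v -> (forall y, y \in r -> K y) ->
  T (v :: r) = 0 -> T (x :: r) = 0.
Proof.
move=> rd Kv Kr Tv; have pos y : K y -> 0 <= T (y :: r).
  by move=> Ky; apply: T_ge0 => //= z; rewrite inE => /predU1P[->|/Kr].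
have [t t0 /pos] := openK_line K_cone x Kv.
have [t' t'0 /pos] := openK_line K_cone (- x) Kv.
rewrite -scaleN1r scalerA !smD// !smZ// Tv !add0r mulrN1 mulNr oppr_ge0.
rewrite pmulr_rle0// pmulr_rge0// => le ge.
by apply/eqP; rewrite eq_le le ge.
Qed.

(** A zero would spread: arguments are replaced one by one by other vectors of [K], then by
    arbitrary ones, since [K] spans the space. *)
Lemma multilinear_positive s0 : size s0 = d -> T s0 != 0 ->
  forall s, size s = d -> (forall x, x \in s -> K x) -> 0 < T s.
Proof.
move=> s0d Ts0 s sd Ks; rewrite lt_neqAle T_ge0// andbT eq_sym.
apply: contraNneq Ts0 => Ts; apply/eqP.
have change l l' r : size l = size l' -> (size l + size r)%N = d ->
    (forall x, x \in l -> K x) -> (forall x, x \in l' -> K x) ->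
    (forall x, x \in r -> K x) -> T (l ++ r) = 0 -> T (l' ++ r) = 0.
  elim: l l' r => [|v l IHl] [|x l'] r //= [ll'] sz Kl Kl' Kr Tl.
  have Kx : K x by apply: Kl'; rewrite mem_head.
  rewrite -T_moveC; apply: IHl => //.
  - by rewrite -sz /= addnS.
  - by move=> y yl; apply: Kl; rewrite inE yl orbT.
  - by move=> y yl; apply: Kl'; rewrite inE yl orbT.
  - by move=> y; rewrite inE => /predU1P[->|/Kr].
  rewrite T_moveC; apply: T_eq0_head Tl.
  - by rewrite size_cat.
  - by apply: Kl; rewrite mem_head.
  - by move=> y; rewrite mem_cat => /orP[yl|/Kr//]; apply: Kl; rewrite inE yl orbT.
have zero t : size t = d -> (forall x, x \in t -> K x) -> T t = 0.
  move=> td Kt; rewrite -[t]cats0; apply: (change s) => //=; rewrite ?addn0 ?cats0//.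
  by rewrite sd.
suff all0 l r : (size l + size r)%N = d -> (forall x, x \in r -> K x) -> T (l ++ r) = 0.
  by rewrite -[s0]cats0; apply: all0 => //; rewrite addn0.
elim: l r => [|x l IHl] r sz Kr; first exact: zero.
have [k1 [k2 [Kk1 Kk2 [c c0 cx]]]] := openK_spans K_cone x.
have Tk k : K k -> T (k :: l ++ r) = 0.
  move=> Kk; rewrite -T_moveC; apply: IHl; first by rewrite -sz /= addnS.
  by move=> y; rewrite inE => /predU1P[->|/Kr].
have : c * T (x :: l ++ r) = 0.
  by rewrite -smZ// cx smD// -scaleN1r smZ// !Tk// mulr0 addr0.
by move/eqP; rewrite mulf_eq0 gt_eqF//= => /eqP.
Qed.

End Positivity.

Section LorentzianCone.
Context {R : realType} {n d : nat} {f : {mpoly R[n]}} {K : set 'rV[R]_n}.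
Hypothesis hd : (2 <= d)%N.
Hypothesis f_homog : f \is d.-homog.
Hypothesis f_neq0 : f != 0.
Hypothesis K_cone : open_convex_cone K.
Hypothesis K_pointed : pointed (closure K).

Local Notation F := (polarization f).
Let Fsm : sym_multilinear F := polarization_multilinear f.

Lemma unit_extreme_closure u : unit_extreme K u -> closure K u.
Proof.
by move=> [_ [rayK _]]; apply: rayK; exists 1; rewrite /= ?ler01 ?scale1r.
Qed.

Lemma hess_form_hyperbolic s : (npos_eig (hess_form s f) <= 1)%N <->
  hyperbolic (fun x y => F [:: x, y & s]).
Proof. exact: npos_eig_le1 (sm_bilinear s Fsm). Qed.

Lemma Lorentzian_weakly : Lorentzian d K f -> weakly_Lorentzian (closure K) d F.
Proof.
move=> [_ _ Lor]; have [[k Kk] _ _ KZ] := K_cone.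
have near v e : closure K v -> 0 < e -> K (v + e *: k).
  by move=> Cv e0; apply: closure_addK => //; exact: KZ.
have tup s : size s = d -> (forall x, x \in s -> K x) ->
    exists2 v : d.-tuple 'rV[R]_n, val v = s & forall i, K (tnth v i).
  move=> /eqP sd Ks; exists (Tuple sd) => // i; apply: Ks.
  by rewrite -[s]/(val (Tuple sd)) mem_tnth.
split=> //.
  apply: (nonneg_limit Fsm near) => s sd Ks.
  by have [v <- /Lor[/ltW]] := tup s sd Ks.
move=> s sd; have {sd} : size s = (d - 2)%N by rewrite -sd subn2.
move: s; apply: (hyperbolic_closure Fsm near) => s sd Ks.
(* Two copies of [k] pad [s] to length [d]; [drop 2] removes them again. *)
have [||v vE /Lor[_ /(_ hd)]] := tup [:: k, k & s].
- by rewrite /= sd -addn2 subnK.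
- by move=> x; rewrite !inE => /or3P[/eqP->|/eqP->|/Ks].
by rewrite -[tval v]/(val v) vE /= drop0 => s1; apply/hess_form_hyperbolic; rewrite s1.
Qed.

Lemma weakly_Lorentzian_Mconvex_mnm m (u : m.-tuple 'rV[R]_n) :
  weakly_Lorentzian (closure K) d F -> (forall i, closure K (tnth u i)) ->
  Mconvex [set alpha : 'X_{1..m} | mdeg alpha = d /\ 0 < mconst (dirderivX u alpha f)].
Proof.
move=> wF Ku; split.
  apply: (@sub_finite_set _ _ [set bmnm a | a in [set: 'X_{1..m < d.+1}]]).
    move=> alpha [da _] /=; have lt : (mdeg alpha < d.+1)%N by rewrite da.
    by exists (BMultinom lt).
  exact/finite_image/finite_finset.
move=> alpha beta [da pa] [db pb] i lt.
rewrite dirderivX_mnm_seq in pa; rewrite dirderivX_mnm_seq in pb.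
have exch := weakly_Lorentzian_Mconvex (closureK0 K_cone) (closureKD K_cone) Ku wF.
have Ja : size (mnm_seq alpha) = d /\ 0 < F (map (tnth u) (mnm_seq alpha)).
  by rewrite size_mnm_seq.
have Jb : size (mnm_seq beta) = d /\ 0 < F (map (tnth u) (mnm_seq beta)).
  by rewrite size_mnm_seq.
have [|j] := exch _ _ Ja Jb i; first by rewrite !count_mnm_seq.
rewrite !count_mnm_seq => lj [sj pj]; exists j; split=> //=.
have ia : i \in mnm_seq alpha.
  by rewrite -has_pred1 has_count count_mnm_seq (leq_ltn_trans _ lt).
have pE : perm_eq (mnm_seq (alpha - U_(i) + U_(j))%MM) (j :: rem i (mnm_seq alpha)).
  apply: perm_mnm_seq => l; rewrite mnmDE mnmBE !mnm1E /= count_rem count_mnm_seq ia/=.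
  by rewrite addnC.
split; first by rewrite -size_mnm_seq (perm_size pE).
by rewrite dirderivX_mnm_seq -/(F _) (Fsm.1 _ _ (perm_map (tnth u) pE)).
Qed.

Section Converse.
Hypothesis F_ge0 : forall u : d.-tuple 'rV[R]_n,
  (forall i, unit_extreme K (tnth u i)) -> 0 <= mconst (dirderivs u f).
Hypothesis F_Mconvex : forall u : (2 * d).-tuple 'rV[R]_n,
  (forall i, unit_extreme K (tnth u i)) ->
  Mconvex [set alpha : 'X_{1..(2 * d)} |
            mdeg alpha = d /\ 0 < mconst (dirderivX u alpha f)].
Hypothesis F_hess : forall u : (d - 2).-tuple 'rV[R]_n,
  (forall i, unit_extreme K (tnth u i)) -> (npos_eig (hess_form u f) <= 1)%N.

(** * Pulling [f] back to the orthant spanned by finitely many extreme vectors *)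

Section Rows.
Context {m : nat} (E : 'M[R]_(m, n)) (SE : forall i, unit_extreme K (row i E)).
Local Notation erow := (fun i => row i E).

Let tup k (a : seq 'I_m) : size a = k ->
  exists2 v : k.-tuple 'rV[R]_n, val v = map erow a & forall i, unit_extreme K (tnth v i).
Proof.
move=> <-; have sz : size (map erow a) == size a by rewrite size_map.
exists (Tuple sz) => // i.
have : tnth (Tuple sz) i \in map erow a by exact: mem_tnth.
by case/mapP => j _ ->.
Qed.

Lemma rows_ge0 a : size a = d -> 0 <= F (map erow a).
Proof. by move=> /tup[v <- /F_ge0]. Qed.

Lemma rows_hyperbolic a : size a = (d - 2)%N ->
  hyperbolic (fun x y => F [:: x, y & map erow a]).
Proof. by move=> /tup[v <- /F_hess]; rewrite hess_form_hyperbolic. Qed.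

(* Members [a] and [b] of the support involve at most [2 * d] of the rows. *)
Lemma rows_Mconvex : seq_Mconvex (fun a => size a = d /\ 0 < F (map erow a)).
Proof.
move=> a b [sa Ta] [sb Tb] i lt; pose s := a ++ b.
have [|u uE Su] := @tup (2 * d)%N s; first by rewrite size_cat sa sb mul2n addnn.
have d0 : (0 < 2 * d)%N by rewrite muln_gt0/= (leq_trans _ hd).
(* Each row index goes to its first position in [s], so later repetitions get exponent zero; the
   default is never reached on members of [s]. *)
pose idx x : 'I_(2 * d) := insubd (Ordinal d0) (index x s).
have idxE x : x \in s -> val (idx x) = index x s.
  move=> xs; rewrite val_insubd ifT//.
  by move: xs; rewrite -index_mem size_cat sa sb mul2n addnn.
have uidx x : x \in s -> tnth u (idx x) = row x E.
  move=> xs; rewrite (tnth_nth 0) idxE// -[tval u]/(val u) uE.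
  by rewrite (nth_map x) ?index_mem// nth_index.
have idx_inj x y : x \in s -> y \in s -> (idx x == idx y) = (x == y).
  move=> xs ys; apply/eqP/eqP => [/(congr1 val)|->//]; rewrite !idxE// => h.
  by rewrite -(nth_index x xs) h nth_index.
have as_ x : x \in a -> x \in s by rewrite mem_cat => ->.
have bs_ x : x \in b -> x \in s by rewrite mem_cat orbC => ->.
have cnt t x : {subset t <= s} -> x \in s ->
    count_mem (idx x) (map idx t) = count_mem x t.
  move=> ts xs; rewrite count_map; apply: eq_in_count => y /ts ys /=.
  exact: idx_inj.
have mapu t : {subset t <= s} -> map (tnth u) (map idx t) = map erow t.
  by move=> ts; rewrite -map_comp; apply/eq_in_map => x /ts /uidx.
pose cm (t : seq 'I_(2 * d)) : 'X_{1..(2 * d)} := [multinom count_mem l t | l < 2 * d].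
have cmE t : perm_eq (mnm_seq (cm t)) t by apply: perm_mnm_seq => l; rewrite mnmE.
have memM t : {subset t <= s} -> size t = d -> 0 < F (map erow t) ->
    mdeg (cm (map idx t)) = d /\ 0 < mconst (dirderivX u (cm (map idx t)) f).
  move=> ts st pt; split; first by rewrite -size_mnm_seq (perm_size (cmE _)) size_map.
  rewrite dirderivX_mnm_seq -/(F _) (Fsm.1 _ _ (perm_map _ (cmE _))).
  by rewrite mapu.
have ia : i \in a by rewrite -has_pred1 has_count (leq_ltn_trans _ lt).
have [_ exch] := F_Mconvex Su.
have [|j [ltj [_ pj]]] := exch _ _ (memM a as_ sa Ta) (memM b bs_ sb Tb) (idx i).
  by rewrite !mnmE !cnt//; exact: as_.
rewrite !mnmE in ltj.
(* The exchange increases a multiplicity that is positive in the image of [b], so [j] comes from a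
   member of [b]. *)
have : j \in map idx b by rewrite -has_pred1 has_count (leq_ltn_trans _ ltj).
case/mapP => x xb jE; exists x.
  by move: ltj; rewrite jE !cnt//; exact: bs_.
split; first by rewrite /= size_rem// prednK// -has_predT; apply/hasP; exists i.
move: pj; rewrite dirderivX_mnm_seq -/(F _) => pj.
have sub : {subset x :: rem i a <= s}.
  by move=> y; rewrite inE => /predU1P[->|/mem_rem/as_//]; exact: bs_.
have pE : perm_eq (mnm_seq (cm (map idx a) - U_(idx i) + U_(j))%MM)
                  (map idx (x :: rem i a)).
  apply: perm_mnm_seq => l; rewrite mnmDE mnmBE !mnm1E mnmE jE /= addnC.
  have /permP -> : perm_eq (map idx a) (idx i :: map idx (rem i a)).
    by rewrite -map_cons perm_map// perm_to_rem.
  by rewrite /= addKn.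
by rewrite -(mapu _ sub) -(Fsm.1 _ _ (perm_map (tnth u) pE)).
Qed.

(** The polarization of the pullback of [f] along [w |-> w *m E]. *)
Let T (ws : seq 'rV[R]_m) : R := F (map (mulmxr E) ws).

Let Tsm : sym_multilinear T.
Proof.
split=> [s t st|c x y s]; first exact/Fsm.1/perm_map.
by rewrite /T /= mulmxDl -scalemxAl Fsm.2.
Qed.

Let T_basis a : T (map (fun i => delta_mx 0 i) a) = F (map erow a).
Proof. by rewrite /T -map_comp; congr F; apply: eq_map => i; rewrite rowE. Qed.

Lemma rows_cone_ge0 ws : size ws = d ->
  (forall w : 'rV_m, w \in ws -> forall i, 0 <= w 0 i) -> 0 <= F (map (mulmxr E) ws).
Proof.
move=> sw w0; apply: (sm_nonneg Tsm) => // a; rewrite sw => sa.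
by rewrite T_basis rows_ge0.
Qed.

Lemma rows_cone_hyperbolic ws : size ws = (d - 2)%N ->
  (forall w : 'rV_m, w \in ws -> forall i, 0 <= w 0 i) ->
  forall a x : 'rV_m, 0 < T [:: a, a & ws] ->
    T [:: x, x & ws] * T [:: a, a & ws] <= T [:: a, x & ws] ^+ 2.
Proof.
have dE : (d - 2).+2 = d by rewrite -addn2 subnK.
move=> sw w0; apply: (hyperbolic_nonneg_directions Tsm _ _ _ sw w0).
- by move=> a; rewrite dE => /rows_ge0; rewrite T_basis.
- move=> a b [sa Ta] [sb Tb] i lt; rewrite !T_basis dE in sa sb Ta Tb.
  have [j ltj [sj Tj]] := rows_Mconvex (conj sa Ta) (conj sb Tb) lt.
  by exists j => //; rewrite T_basis dE.
- move=> a /rows_hyperbolic h b x; have := h (b *m E) (x *m E).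
  have bE s : T [:: s.1, s.2 & map (fun i => delta_mx 0 i) a] =
              F [:: s.1 *m E, s.2 *m E & map erow a].
    rewrite /T /= -map_comp; congr (F [:: _, _ & _]).
    by apply: eq_map => i; rewrite /= rowE.
  by have := (bE (b, x), bE (b, b), bE (x, x)) => /= -[[-> ->] ->].
Qed.

End Rows.

Lemma closure_common_rows vs : (forall v, v \in vs -> closure K v) ->
  exists m (E : 'M[R]_(m, n)), (forall i, unit_extreme K (row i E)) /\
    exists2 ws, (forall w : 'rV_m, w \in ws -> forall i, 0 <= w 0 i) &
      vs = map (mulmxr E) ws.
Proof.
move=> Cvs; have [v /Cvs|m [E [SE h]]] := @conic_span_common _ _ (unit_extreme K) vs.
  exact: closureK_conic.
exists m, E; split=> //; elim: vs h {Cvs} => [|v vs IHvs] h; first by exists [::].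
have [w w0 ->] := h v (mem_head _ _).
have [x xs|ws ws0 ->] := IHvs; first by apply: h; rewrite inE xs orbT.
by exists (w :: ws) => // y; rewrite inE => /predU1P[->|/ws0].
Qed.

Lemma closure_ge0 vs : size vs = d -> (forall v, v \in vs -> closure K v) -> 0 <= F vs.
Proof.
move=> sv /closure_common_rows[m [E [SE [ws w0 vE]]]].
by rewrite vE rows_cone_ge0// -sv vE size_map.
Qed.

Lemma closure_hyperbolic vs : size vs = (d - 2)%N ->
  (forall v, v \in vs -> closure K v) -> hyperbolic (fun x y => F [:: x, y & vs]).
Proof.
move=> sv Cvs a x; have KC k : K k -> closure K k by exact: subset_closure.
(* The vectors [a] and [x] are arbitrary; as scaled differences of cone elements they can be pulled
   back together with [vs]. *)
have [k1 [k2 [K1 K2 [c c0 ca]]]] := openK_spans K_cone a.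
have [k3 [k4 [K3 K4 [c' c'0 cx]]]] := openK_spans K_cone x.
have [v|m [E [SE [ws w0 vE]]]] := @closure_common_rows [:: k1, k2, k3, k4 & vs].
  rewrite !inE => /orP[/eqP->|]; first exact: KC.
  move=> /orP[/eqP->|]; first exact: KC.
  move=> /orP[/eqP->|]; first exact: KC.
  by move=> /orP[/eqP->|/Cvs//]; exact: KC.
case: ws w0 vE => [//|w1 [//|w2 [//|w3 [//|w4 ws]]]] w0 [k1E k2E k3E k4E vE].
have aE : a = c^-1 *: (w1 - w2) *m E.
  by rewrite -scalemxAl mulmxBl -k1E -k2E -ca scalerA mulVf ?scale1r ?gt_eqF.
have xE : x = c'^-1 *: (w3 - w4) *m E.
  by rewrite -scalemxAl mulmxBl -k3E -k4E -cx scalerA mulVf ?scale1r ?gt_eqF.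
rewrite aE xE vE; apply: (rows_cone_hyperbolic SE).
  by rewrite -sv vE size_map.
by move=> w ww; apply: w0; rewrite !inE ww !orbT.
Qed.

(** Nonnegativity and [f != 0] give strict positivity on [K]. Hyperbolicity allows at most one
    positive eigenvalue, and the positive value of the Hessian at [v0] provides one. *)
Lemma Lorentzian_of_extreme : Lorentzian d K f.
Proof.
split=> //; first exact: leq_trans hd.
move=> v Kv; have KC k : K k -> closure K k by exact: subset_closure.
have Kmem x : x \in val v -> K x by case/tnthP => i ->; exact: Kv.
have [s0 s0d Fs0] := polarization_neq0 f_homog f_neq0.
have F_ge0' s : size s = d -> (forall x, x \in s -> K x) -> 0 <= F s.
  by move=> sd Ks; apply: closure_ge0 => // x /Ks/KC.
have F_gt0 := multilinear_positive K_cone Fsm F_ge0' s0d Fs0.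
split=> [|_]; first by apply: F_gt0; [rewrite size_tuple|exact: Kmem].
have drop2 : size (drop 2 v) = (d - 2)%N by rewrite size_drop size_tuple.
have Kdrop x : x \in drop 2 v -> K x by move=> /mem_drop/Kmem.
pose v0 := tnth v (Ordinal (leq_trans (isT : (0 < 2)%N) hd)).
apply/eqP; rewrite eqn_leq; apply/andP; split.
  by apply/hess_form_hyperbolic/closure_hyperbolic => // x /Kdrop/KC.
apply: (npos_eig_gt0 (sm_bilinear (drop 2 v) Fsm) (x := v0)); apply: F_gt0.
  by rewrite /= drop2 -[in RHS](subnK hd) addn2.
by move=> x; rewrite !inE => /or3P[/eqP->|/eqP->|/Kdrop//]; exact: Kv.
Qed.

End Converse.

End LorentzianCone.

(** The zero polynomial satisfies the three conditions without being Lorentzian, and a closed convex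
    cone containing a line has no extreme rays; hence [f_neq0] and [K_pointed]. *)
Theorem theorem8p12 (R : realType) (n d : nat) (f : {mpoly R[n]})
    (K : set 'rV[R]_n)
    (hd : (2 <= d)%N) (f_homog : f \is d.-homog) (f_neq0 : f != 0)
    (K_cone : open_convex_cone K) (K_pointed : pointed (closure K)) :
  Lorentzian d K f <->
  [/\ (forall u : d.-tuple 'rV[R]_n,
         (forall i, unit_extreme K (tnth u i)) ->
         0 <= mconst (dirderivs u f)),
      (forall u : (2 * d).-tuple 'rV[R]_n,
         (forall i, unit_extreme K (tnth u i)) ->
         Mconvex [set alpha : 'X_{1..(2 * d)} |
                   mdeg alpha = d /\ 0 < mconst (dirderivX u alpha f)]) &
      (forall u : (d - 2).-tuple 'rV[R]_n,
         (forall i, unit_extreme K (tnth u i)) ->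
         (npos_eig (hess_form u f) <= 1)%N)].
Proof.
split=> [Lor|[F_ge0 F_Mconvex F_hess]]; last exact: Lorentzian_of_extreme.
have wF := Lorentzian_weakly hd K_cone Lor.
have SK k (u : k.-tuple 'rV[R]_n) : (forall i, unit_extreme K (tnth u i)) ->
    forall i, closure K (tnth u i) by move=> Su i; exact: unit_extreme_closure.
have [_ wF_ge0 wF_hyp] := wF; split=> u /SK Cu.
- by apply: wF_ge0; [rewrite size_tuple|move=> x /tnthP[i ->]].
- exact (weakly_Lorentzian_Mconvex_mnm K_cone wF Cu).
- apply/hess_form_hyperbolic/wF_hyp; first by rewrite size_tuple -addn2 subnK.
  by move=> x /tnthP[i ->].
Qed.
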